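(* The group $\mathrm{Diff}^\infty_{\mathrm{ap}}(\mathbb{R}^n)$ has a well-defined ($C^1_F$-smooth) Lie group exponential map $\mathrm{Exp}_{\mathrm{LG}}:C^\infty_{\mathrm{ap}}(\mathbb{R}^n,\mathbb{R}^n)\to\mathrm{Diff}^\infty_{\mathrm{ap}}(\mathbb{R}^n)$ such that $d_0\mathrm{Exp}_{\mathrm{LG}}=\mathrm{id}_{C^\infty_{\mathrm{ap}}}$ and, for every non-zero constant vector $c\in\mathbb{R}^n$ (viewed as a constant vector field), there exists a non-zero $\delta u\in C^\infty_{\mathrm{ap}}(\mathbb{R}^n,\mathbb{R}^n)$ with $(d_c\mathrm{Exp}_{\mathrm{LG}})(\delta u)=0$.
   Context: Hölder/almost periodic spaces: for integer $k\ge0$, $C^k_b(\mathbb{R}^n,\mathbb{R})$ is the space of $C^k$ functions with bounded continuous derivatives of order $\le k$, norm $|f|_k=\max_{|\beta|\le k}\sup|\partial^\beta f|$; $C^k_{\mathrm{ap}}=\{f\in C^k_b:\{f(\cdot+c)\}_{c\in\mathbb{R}^n}\text{ precompact in }C^k_b\}$; $C^\infty_{\mathrm{ap}}=\bigcap_{k\ge1}C^k_{\mathrm{ap}}$ with the Fréchet topology of the norms $|\cdot|_k$; vector-valued versions componentwise. $\mathrm{Diff}^\infty_{\mathrm{ap}}(\mathbb{R}^n)$ is the group (under composition) of maps $\varphi=\mathrm{id}+f$ with $f\in C^\infty_{\mathrm{ap}}(\mathbb{R}^n,\mathbb{R}^n)$ and $\inf_x\det(I+[d_xf])>0$, with the Fréchet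 topology of $f$. For $u\in C^\infty_{\mathrm{ap}}(\mathbb{R}^n,\mathbb{R}^n)$, $\mathrm{Exp}_{\mathrm{LG}}(u)=\varphi(1)$ where $\varphi\in C^1_F([0,\infty),\mathrm{Diff}^\infty_{\mathrm{ap}}(\mathbb{R}^n))$ is the unique solution of $\dot\varphi=u\circ\varphi$, $\varphi(0)=\mathrm{id}$. $C^1_F$ means Fréchet continuously differentiable: directional derivatives $d_xF(h)=\lim_{\varepsilon\to0}(F(x+\varepsilon h)-F(x))/\varepsilon$ exist and $(x,h)\mapsto d_xF(h)$ is continuous. *)

(* Defs.v *)
From HB Require Import structures.
From mathcomp Require Import all_boot all_order all_algebra.
From mathcomp Require Import all_classical all_reals all_analysis.
Set Implicit Arguments. Unset Strict Implicit. Unset Printing Implicit Defensive.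
Import Order.TTheory GRing.Theory Num.Theory.
Import numFieldNormedType.Exports.
Local Open Scope ring_scope.

Definition evec (R : realType) (n : nat) (i : 'I_n) : 'rV[R]_n := delta_mx 0 i.

Definition partial (R : realType) (n : nat) (i : 'I_n)
  (f : 'rV[R]_n -> R) : 'rV[R]_n -> R :=
  fun x => derive f x (evec R i).

Definition pd (R : realType) (n : nat) (s : seq 'I_n) (f : 'rV[R]_n -> R)
  : 'rV[R]_n -> R := foldr (@partial R n) f s.

Definition Ckb (R : realType) (n k : nat) (f : 'rV[R]_n -> R) : Prop :=
  (forall s : seq 'I_n, (size s < k)%N ->
     forall (i : 'I_n) (x : 'rV[R]_n), derivable (pd s f) x (evec R i)) /\
  (forall s : seq 'I_n, (size s <= k)%N ->
     continuous (pd s f) /\ exists M : R, forall x, `|pd s f x| <= M).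

Definition translate (R : realType) (n : nat) (c : 'rV[R]_n)
  (f : 'rV[R]_n -> R) : 'rV[R]_n -> R := fun y => f (y + c).

(* C^k_ap: f in C^k_b and the family of translates {f(.+c)} is precompact in
   the Banach space C^k_b, i.e. totally bounded for |.|_k (sup of the
   derivatives of order <= k). *)
Definition Ckap (R : realType) (n k : nat) (f : 'rV[R]_n -> R) : Prop :=
  Ckb k f /\
  forall eps : R, 0 < eps ->
    exists cs : seq 'rV[R]_n, forall c : 'rV[R]_n,
      exists2 c', c' \in cs &
        forall (s : seq 'I_n) (x : 'rV[R]_n), (size s <= k)%N ->
          `|pd s (translate c f) x - pd s (translate c' f) x| <= eps.

Definition Cinfap (R : realType) (n : nat) (f : 'rV[R]_n -> R) : Prop :=
  forall k : nat, (1 <= k)%N -> Ckap k f.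

Definition comp (R : realType) (n : nat) (i : 'I_n)
  (g : 'rV[R]_n -> 'rV[R]_n) : 'rV[R]_n -> R := fun x => g x 0 i.

Definition Cinfap_v (R : realType) (n : nat) (g : 'rV[R]_n -> 'rV[R]_n) : Prop :=
  forall i : 'I_n, Cinfap (comp i g).

(* |g|_k <= eps, where |g|_k = max_i max_{|s|<=k} sup_x |d^s g_i (x)| *)
Definition nle (R : realType) (n k : nat) (g : 'rV[R]_n -> 'rV[R]_n) (eps : R)
  : Prop :=
  forall (i : 'I_n) (s : seq 'I_n) (x : 'rV[R]_n), (size s <= k)%N ->
    `|pd s (comp i g) x| <= eps.

Definition jac (R : realType) (n : nat) (f : 'rV[R]_n -> 'rV[R]_n)
  (x : 'rV[R]_n) : 'M[R]_n :=
  \matrix_(i, j) partial j (comp i f) x.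

Definition Diffap (R : realType) (n : nat) (phi : 'rV[R]_n -> 'rV[R]_n) : Prop :=
  let f := fun x => phi x - x in
  Cinfap_v f /\
  exists m : R, 0 < m /\ forall x, m <= \det (1%:M + jac f x).

(* phi : [0,oo) -> Diff^infty_ap is a C^1_F solution of dphi/dt = u o phi,
   phi(0) = id, the derivative being taken in the Frechet topology of
   C^infty_ap (one-sided at t = 0). *)
Definition is_flow (R : realType) (n : nat) (u : 'rV[R]_n -> 'rV[R]_n)
  (phi : R -> 'rV[R]_n -> 'rV[R]_n) : Prop :=
  phi 0 = id /\
  (forall t : R, 0 <= t -> Diffap (phi t)) /\
  exists dphi : R -> 'rV[R]_n -> 'rV[R]_n,
    (forall t : R, 0 <= t ->
       Cinfap_v (dphi t) /\
       (forall (k : nat) (eps : R), 0 < eps -> exists2 delta : R, 0 < delta &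
          forall e : R, e != 0 -> `|e| < delta -> 0 <= t + e ->
            nle k (fun x => e^-1 *: (phi (t + e) x - phi t x) - dphi t x) eps) /\
       (forall x, dphi t x = u (phi t x))) /\
    (forall t0 : R, 0 <= t0 ->
       forall (k : nat) (eps : R), 0 < eps -> exists2 delta : R, 0 < delta &
         forall t : R, 0 <= t -> `|t - t0| < delta ->
           nle k (fun x => dphi t x - dphi t0 x) eps).

(* L = d_x F (h) = lim_{e -> 0} (F(x + e h) - F(x)) / e in the Frechet
   topology of C^infty_ap *)
Definition is_dirder (R : realType) (n : nat)
  (F : ('rV[R]_n -> 'rV[R]_n) -> ('rV[R]_n -> 'rV[R]_n))
  (x h L : 'rV[R]_n -> 'rV[R]_n) : Prop :=
  forall (k : nat) (eps : R), 0 < eps -> exists2 delta : R, 0 < delta &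
    forall e : R, e != 0 -> `|e| < delta ->
      nle k (fun y => e^-1 *: (F (fun z => x z + e *: h z) y - F x y) - L y) eps.

(* F is C^1_F on C^infty_ap(R^n,R^n): all directional derivatives exist (in
   C^infty_ap) and (x,h) |-> d_x F(h) is continuous for the Frechet topology
   (the seminorms |.|_k are increasing in k). *)
Definition C1F (R : realType) (n : nat)
  (F : ('rV[R]_n -> 'rV[R]_n) -> ('rV[R]_n -> 'rV[R]_n)) : Prop :=
  exists DF : ('rV[R]_n -> 'rV[R]_n) -> ('rV[R]_n -> 'rV[R]_n) -> ('rV[R]_n -> 'rV[R]_n),
    (forall x h, Cinfap_v x -> Cinfap_v h ->
       Cinfap_v (DF x h) /\ is_dirder F x h (DF x h)) /\
    (forall x0 h0, Cinfap_v x0 -> Cinfap_v h0 ->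
       forall (k : nat) (eps : R), 0 < eps ->
         exists k' : nat, exists2 delta : R, 0 < delta &
           forall x h, Cinfap_v x -> Cinfap_v h ->
             nle k' (fun y => x y - x0 y) delta ->
             nle k' (fun y => h y - h0 y) delta ->
             nle k (fun y => DF x h y - DF x0 h0 y) eps).

(* Main.v *)
(** Everything is obtained from the Euler scheme [Exp u = lim (id + u/N)^N], by
    C^0 estimates only, and interpolation between C^0 and high C^m norms.

    Composition with [id + t v] is a linear operator of norm [1 + O(t)] on C^m,
    so the Euler iterates stay bounded in C^m, uniformly in [u] on bounded sets;
    their uniform limit is then smooth with the same bounds, and any C^0-small
    quantity bounded in all C^m is small in every C^k.  Translations conjugate
    [Exp u] to [Exp] of the translate of [u], which gives almost periodicity.

    For the derivative, the quotients [Q_e = (Exp (u + e h) - Exp u) / e] satisfy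
    [|Q_e - Q_e'| <= C (|e| + |e'|)] in C^0 by a discrete Gronwall estimate, while
    their C^m norms are only known to be [O(1/e)]; interpolating with [m] large
    compared with [k] still yields convergence in C^k.

    At a non-zero constant [c] take [h] with [h (x + c/2) = - h x]: the first
    order effect of [h] along the orbit [x + t c], [0 <= t <= 1], cancels. *)
From Pilot Require Import Defs.
From HB Require Import structures.
From mathcomp Require Import all_boot all_order all_algebra perm.
From mathcomp Require Import all_classical all_reals all_analysis.
From mathcomp Require Import ring lra.
Set Implicit Arguments. Unset Strict Implicit. Unset Printing Implicit Defensive.
Import Order.TTheory GRing.Theory Num.Theory.
Import numFieldNormedType.Exports.
(* Reimported so that [Defs.comp] shadows [ssrfun.comp]. *)
Import Pilot.Defs.
Local Open Scope ring_scope.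

(** The obstacle is loss of derivatives: differentiating [u o phi] in [phi] costs one derivative of
    [u], so an estimate of order m for the linearised equation asks for order m + 1 of the data, and
    a fixed-point argument in a single C^m space does not close up. In C^0 the loss is harmless,
    because all data have bounded derivatives of every order; interpolation then recovers the higher
    norms.

    Joint continuity of the derivative needs more than convergence of the quotients: a C^m bound on
    it that is uniform for bounded (u, h), although the quotients are only known to be O(1/e) there.
    It is read off along a geometric sequence of values of e, where the interpolated increments are
    summable.

    Two facts have their own mechanism. The lower bound on the Jacobian determinant comes from
    multiplicativity along the Euler steps, each contributing a factor at least [1 - D/N].
    Uniqueness concerns arbitrary flows and is a Gronwall estimate for the squared distance. The
    kernel direction at [c] is the field sin(2 pi x_j / c_j) e_j, for a coordinate with c_j
    non-zero. *)

Lemma rv_entry (R : realType) (n : nat) (x : 'rV[R]_n) i : `|x 0 i| <= `|x|.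
Proof.
rewrite [leRHS]/Num.norm /= mx_normrE.
by apply: (le_bigmax _ (fun ij => `|x ij.1 ij.2|) (0, i)).
Qed.

Lemma rv_norm_le (R : realType) (n : nat) (x : 'rV[R]_n) r :
  0 <= r -> (forall i, `|x 0 i| <= r) -> `|x| <= r.
Proof.
move=> r0 xr; rewrite [leLHS]/Num.norm /= mx_normrE; apply/bigmax_leP; split=> //.
by move=> [i j] _ /=; rewrite (ord1 i).
Qed.

Lemma evec_norm (R : realType) (n : nat) (i : 'I_n) : `|evec R i| = 1.
Proof.
apply/eqP; rewrite eq_le; apply/andP; split.
  apply: rv_norm_le => // j; rewrite mxE eqxx /=.
  by case: eqP => _; rewrite ?normr1 ?normr0.
by have := rv_entry (evec R i) i; rewrite mxE !eqxx normr1.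
Qed.

(** A remainder [C * h ^+ 2] is exactly what bounds on second derivatives deliver; both the chain
    rule and the differentiation of uniform limits go through this criterion. *)
Lemma is_derive_quadratic (R : realType) (V : normedModType R) (f : V -> R)
    (x v : V) (d C : R) :
  (forall h, `|h| <= 1 -> `|f (x + h *: v) - f x - h * d| <= C * h ^+ 2) ->
  is_derive x v f d.
Proof.
move=> fC.
have C0 : 0 <= C.
  have := fC 1; rewrite normr1 lexx expr1n mulr1 => /(_ erefl).
  exact: le_trans.
have cv : ((fun h => h^-1 *: ((f \o shift x) (h *: v) - f x)) @ 0^' --> d)%classic.
  apply/cvgrPdist_le => e e0.
  have e1 : 0 < Num.min 1 (e / (C + 1)).
    by rewrite lt_min ltr01 divr_gt0 // ltr_wpDl.
  near=> h.
  have h0 : h != 0 by near: h; exact: nbhs_dnbhs_neq.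
  have hd : `|h| <= Num.min 1 (e / (C + 1)).
    near: h; apply: dnbhs0_le => //.
  move: hd; rewrite le_min => /andP[h1 h2].
  have := fC h h1; rewrite /= (addrC x) => fh.
  rewrite distrC -(ler_pM2l (_ : 0 < `|h|)) ?normr_gt0 // -normrM mulrBr.
  rewrite /GRing.scale /= mulVKf //.
  apply: le_trans fh _.
  rewrite -[h ^+ 2]real_normK ?num_real // expr2 mulrCA ler_wpM2l //.
  rewrite ler_pdivlMr in h2; last by rewrite ltr_wpDl.
  apply: le_trans h2; rewrite mulrC ler_wpM2l //.
  by rewrite lerDl.
split; last by apply/cvg_lim.
by apply/cvg_ex; exists d.
Unshelve. all: by end_near.
Qed.

Lemma is_derive_line (R : realType) (V : normedModType R) (f : V -> R)
    (x v : V) (r : R) :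
  derivable f (x + r *: v) v ->
  is_derive r 1 (fun r => f (x + r *: v)) ('D_v f (x + r *: v)).
Proof.
move=> df.
have E : (fun h : R => h^-1 *: (((fun r => f (x + r *: v)) \o shift r) (h *: 1) -
   f (x + r *: v))) =
   (fun h => h^-1 *: ((f \o shift (x + r *: v)) (h *: v) - f (x + r *: v))).
  apply/funext => h /=; congr (_ *: (f _ - _)).
  by rewrite [h *: 1]mulr1 scalerDl addrCA.
split; first by rewrite /derivable E.
by rewrite /derive E.
Qed.

Lemma mvt_line (R : realType) (V : normedModType R) (f : V -> R) (v x : V) (h : R) :
  (forall y, derivable f y v) ->
  exists2 t, `|t| <= `|h| & f (x + h *: v) - f x = h * 'D_v f (x + t *: v).
Proof.
move=> df; pose g r := f (x + r *: v); pose dg r := 'D_v f (x + r *: v).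
have gd (r : R) : is_derive (r : R) (1 : R) g (dg r) by apply: is_derive_line.
have gc (a b : R) : {within `[a, b], continuous g}%classic.
  by apply: derivable_within_continuous => r _; case: (gd r).
have fx : f x = g 0 by rewrite /g scale0r addr0.
have [h0|h0|->] := ltgtP h 0; last first.
- by exists 0 => //; rewrite mul0r scale0r addr0 subrr.
- have [c] := MVT h0 (fun r _ => gd r) (gc _ _).
  rewrite in_itv /= => /andP[c0 ch] E; exists c.
    by rewrite !gtr0_norm // ltW.
  by rewrite fx -[f _]/(g h) E subr0 mulrC.
have [c] := MVT h0 (fun r _ => gd r) (gc _ _).
rewrite in_itv /= => /andP[hc c0] E; exists c.
  by rewrite (ltr0_norm c0) (ltr0_norm h0) lerN2 ltW.
by rewrite fx -[f _]/(g h) -opprB E sub0r mulrN opprK mulrC.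
Qed.

(** * Mean value theorem in several variables *)

Section Telescope.
Context {R : realType} {n : nat}.
Implicit Types (f : 'rV[R]_n -> R) (x a : 'rV[R]_n).

Definition head_row (k : nat) a : 'rV[R]_n :=
  \row_i (if (i < k)%N then a 0 i else 0).

Lemma head_row0 a : head_row 0 a = 0.
Proof. by apply/rowP => i; rewrite !mxE. Qed.

Lemma head_rown a : head_row n a = a.
Proof. by apply/rowP => i; rewrite !mxE ltn_ord. Qed.

Lemma head_rowS (k : 'I_n) a :
  head_row k.+1 a = head_row k a + a 0 k *: evec R k.
Proof.
apply/rowP => i; rewrite !mxE eqxx /= ltnS leq_eqVlt.
have [->|ik] := eqVneq i k; first by rewrite eqxx ltnn mulr1 add0r.
by rewrite (negbTE (_ : val i != val k)) //= mulr0 addr0.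
Qed.

Lemma head_row_norm k a : `|head_row k a| <= `|a|.
Proof.
apply: rv_norm_le => // i; rewrite mxE; case: ifP => _; first exact: rv_entry.
by rewrite normr0.
Qed.

(* Moving one coordinate at a time reduces several variables to the
   one-dimensional mean value theorem. *)
Lemma mvt_telescope f x a :
  (forall i y, derivable f y (evec R i)) ->
  exists2 y : 'I_n -> 'rV[R]_n, (forall i, `|y i| <= 2 * `|a|) &
    f (x + a) - f x = \sum_i a 0 i * partial i f (x + y i).
Proof.
move=> df.
have step (i : 'I_n) : exists y : 'rV[R]_n, `|y| <= 2 * `|a| /\
    f (x + head_row i.+1 a) - f (x + head_row i a) = a 0 i * partial i f (x + y).
  have [t ta E] := mvt_line (x + head_row i a) (a 0 i) (df i).
  exists (head_row i a + t *: evec R i); split.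
    (* One [|a|] pays for the coordinates already moved, the other for the partial move along the
       current one. *)
    apply: le_trans (ler_normD _ _) _; rewrite normrZ evec_norm mulr1 mulr2n.
    rewrite mulrDl mul1r lerD ?head_row_norm //.
    exact: le_trans ta (rv_entry _ _).
  by rewrite head_rowS addrA E /partial -addrA.
have /(_ _)/cid := step; move=> /all_sig[y yP].
exists y => [i|]; first by have [] := yP i.
under eq_bigr => i _ do rewrite -(proj2 (yP i)).
rewrite -(big_mkord xpredT (fun i => f (x + head_row i.+1 a) - f (x + head_row i a))).
by rewrite telescope_sumr // head_row0 head_rown addr0.
Qed.

End Telescope.

(** * Functions with bounded derivatives *)

Section Cbn.
Context {R : realType} {n : nat}.
Implicit Types (f g : 'rV[R]_n -> R) (x a : 'rV[R]_n).

(* The C^m-norm is at most [M]; unlike in [Ckb], the derivatives of top order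
   need not be continuous. *)
Fixpoint cbn (m : nat) (M : R) f : Prop :=
  (forall x, `|f x| <= M) /\
  (if m is m'.+1 then
     forall i, (forall x, derivable f x (evec R i)) /\ cbn m' M (partial i f)
   else True).

Definition CB f := forall m, exists M, cbn m M f.

Lemma cbn_bound m M f x : cbn m M f -> `|f x| <= M.
Proof. by case: m => [|m] []. Qed.

Lemma cbn_ge0 m M f : cbn m M f -> 0 <= M.
Proof. by move=> /(cbn_bound 0); apply: le_trans. Qed.

Lemma cbnW m m' M M' f : (m' <= m)%N -> M <= M' -> cbn m M f -> cbn m' M' f.
Proof.
elim: m' m f => [|m' IH] [|m] f //= mm MM' [fM].
- by move=> _; split=> // x; apply: le_trans (fM x) MM'.
- by move=> _; split=> // x; apply: le_trans (fM x) MM'.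
move=> df; split=> [x|i]; first exact: le_trans (fM x) MM'.
by have [? /IH-IHf] := df i; split=> //; apply: IHf.
Qed.

Lemma cbn_derivable m M f x i : cbn m.+1 M f -> derivable f x (evec R i).
Proof. by case=> _ /(_ i)[]. Qed.

Lemma cbn_partial m M f i : cbn m.+1 M f -> cbn m M (partial i f).
Proof. by case=> _ /(_ i)[]. Qed.

Lemma CB_partial f i : CB f -> CB (partial i f).
Proof. by move=> cf m; have [M /cbn_partial ?] := cf m.+1; exists M. Qed.

Lemma CB_derivable f x i : CB f -> derivable f x (evec R i).
Proof. by move=> cf; have [M /cbn_derivable] := cf 1%N. Qed.

Lemma cbn_lip M f x y : cbn 1 M f -> `|f x - f y| <= n%:R * M * `|x - y|.
Proof.
move=> cf; have [z _] := mvt_telescope y (x - y) (fun i y => cbn_derivable cf).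
rewrite subrKC => ->.
apply: le_trans (ler_norm_sum _ _ _) _.
apply: le_trans (ler_sum _ (_ : forall i, _ -> _ <= M * `|x - y|)) _.
  move=> i _; rewrite normrM mulrC ler_pM ?rv_entry //.
  exact: cbn_bound (cbn_partial i cf).
by rewrite sumr_const card_ord -[leLHS]mulr_natl mulrA.
Qed.

(** Each partial derivative at an intermediate point is moved back to [x] by [cbn_lip], over a
    distance at most [2 * |a|]. One factor n comes from the sum, the other from the Lipschitz
    constant. *)
Lemma cbn_taylor M f x a : cbn 2 M f ->
  `|f (x + a) - f x - \sum_i a 0 i * partial i f x| <= 2 * n%:R ^+ 2 * M * `|a| ^+ 2.
Proof.
move=> cf; have [z za ->] := mvt_telescope x a (fun i y => cbn_derivable cf).
rewrite -sumrB; apply: le_trans (ler_norm_sum _ _ _) _.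
apply: le_trans (ler_sum _ (_ : forall i, _ -> _ <= `|a| * (n%:R * M * (2 * `|a|)))) _.
  move=> i _; rewrite -mulrBr normrM ler_pM ?rv_entry //.
  apply: le_trans (cbn_lip _ _ (cbn_partial i cf)) _.
  rewrite (addrC x) addrK ler_wpM2l //.
  by rewrite mulr_ge0 // (cbn_ge0 cf).
rewrite sumr_const card_ord -[leLHS]mulr_natl.
by rewrite le_eqVlt; apply/orP; left; apply/eqP; ring.
Qed.

End Cbn.

(** * Operations on functions with bounded derivatives; composition with near-identity maps *)

Section CbnAlgebra.
Context {R : realType} {n : nat}.
Implicit Types (f g : 'rV[R]_n -> R) (x a : 'rV[R]_n) (v : 'rV[R]_n -> 'rV[R]_n).

Lemma partialE i f (df : 'rV[R]_n -> R) :
  (forall x, is_derive x (evec R i) f (df x)) -> partial i f = df.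
Proof. by move=> fd; apply/funext => x; rewrite /partial derive_val. Qed.

Lemma is_derive_partial m M f x i :
  cbn m.+1 M f -> is_derive x (evec R i) f (partial i f x).
Proof. by move=> cf; apply: DeriveDef => //; exact: cbn_derivable cf. Qed.

Lemma cbnS_intro m M f (df : 'I_n -> 'rV[R]_n -> R) :
  (forall x, `|f x| <= M) ->
  (forall i x, is_derive x (evec R i) f (df i x)) ->
  (forall i, cbn m M (df i)) -> cbn m.+1 M f.
Proof.
move=> fM fd dfM; split=> // i; split=> [x|]; first by case: (fd i x).
by rewrite (partialE (fd i)).
Qed.

Lemma cbn_cst m c : cbn m `|c| (fun _ : 'rV[R]_n => c).
Proof.
elim: m c => [|m IH] c; first by split.
apply: (@cbnS_intro _ _ _ (fun _ _ => 0)) => // i.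
by apply: cbnW (IH 0); rewrite ?normr0.
Qed.

Lemma cbnD m M M' f g :
  cbn m M f -> cbn m M' g -> cbn m (M + M') (fun x => f x + g x).
Proof.
elim: m f g => [|m IH] f g cf cg.
  split=> // x; apply: le_trans (ler_normD _ _) _.
  by rewrite lerD // ?(cbn_bound _ cf) ?(cbn_bound _ cg).
apply: (@cbnS_intro _ _ _ (fun i x => partial i f x + partial i g x)) => [x|i x|i].
- apply: le_trans (ler_normD _ _) _.
  by rewrite lerD // ?(cbn_bound _ cf) ?(cbn_bound _ cg).
- exact: is_deriveD (is_derive_partial x i cf) (is_derive_partial x i cg).
- by apply: IH; apply: cbn_partial.
Qed.

Lemma cbnZ m M (a : R) f : cbn m M f -> cbn m (`|a| * M) (fun x => a * f x).
Proof.
elim: m f => [|m IH] f cf.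
  by split=> // x; rewrite normrM ler_wpM2l // (cbn_bound _ cf).
apply: (@cbnS_intro _ _ _ (fun i x => a * partial i f x)) => [x|i x|i].
- by rewrite normrM ler_wpM2l // (cbn_bound _ cf).
- by have := @is_deriveZ _ _ _ f a x _ _ (is_derive_partial x i cf).
- by apply: IH; apply: cbn_partial.
Qed.

Lemma cbnB m M M' f g :
  cbn m M f -> cbn m M' g -> cbn m (M + M') (fun x => f x - g x).
Proof.
move=> cf /(cbnZ (-1)); rewrite normrN1 mul1r => cg.
have -> : (fun x => f x - g x) = (fun x => f x + -1 * g x).
  by apply/funext => x; rewrite mulN1r.
exact: cbnD.
Qed.

(** The Leibniz rule doubles the number of terms with every derivative, hence [2 ^+ m]. *)
Lemma cbnM m M M' f g :
  cbn m M f -> cbn m M' g -> cbn m (2 ^+ m * (M * M')) (fun x => f x * g x).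
Proof.
elim: m M M' f g => [|m IH] M M' f g cf cg.
  split=> // x; rewrite expr0 mul1r normrM.
  by rewrite ler_pM // ?(cbn_bound _ cf) ?(cbn_bound _ cg).
apply: (@cbnS_intro _ _ _ (fun i x => f x * partial i g x + g x * partial i f x)).
- move=> x; rewrite normrM; apply: (@le_trans _ _ (M * M')).
    by rewrite ler_pM // ?(cbn_bound _ cf) ?(cbn_bound _ cg).
  rewrite ler_peMl ?mulr_ge0 ?(cbn_ge0 cf) ?(cbn_ge0 cg) //.
  by rewrite exprn_ege1 // ler1n.
- by move=> i x; exact: is_deriveM (is_derive_partial x i cf) (is_derive_partial x i cg).
move=> i.
have -> : 2 ^+ m.+1 * (M * M') = 2 ^+ m * (M * M') + 2 ^+ m * (M' * M).
  by rewrite exprS; ring.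
have [cf' cg'] := (cbnW (leqnSn m) (lexx M) cf, cbnW (leqnSn m) (lexx M') cg).
exact: cbnD (IH _ _ _ _ cf' (cbn_partial i cg)) (IH _ _ _ _ cg' (cbn_partial i cf)).
Qed.

Lemma cbn_sum k m M (F : 'I_k -> 'rV[R]_n -> R) :
  (forall i, cbn m M (F i)) -> cbn m (k%:R * M) (fun x => \sum_i F i x).
Proof.
elim: k F => [|k IH] F cF.
  have -> : (fun x => \sum_(i < 0) F i x) = fun=> 0.
    by apply/funext => x; rewrite big_ord0.
  by rewrite mul0r; have := cbn_cst m 0; rewrite normr0.
have -> : (fun x => \sum_i F i x) = fun x => F ord0 x + \sum_(i < k) F (lift ord0 i) x.
  by apply/funext => x; rewrite big_ord_recl.
rewrite -natr1 mulrDl mul1r addrC; apply: cbnD => //.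
exact: (IH (fun i => F (lift ord0 i)) (fun i => cF _)).
Qed.

Lemma partial_translate i c f :
  partial i (fun x => f (x + c)) = fun x => partial i f (x + c).
Proof.
apply/funext => x; rewrite /partial /derive.
suff -> : (fun h : R => h^-1 *: (((fun y => f (y + c)) \o shift x) (h *: evec R i) - f (x + c)))
  = (fun h => h^-1 *: ((f \o shift (x + c)) (h *: evec R i) - f (x + c))) by [].
by apply/funext => h /=; rewrite addrA.
Qed.

Lemma cbn_translate m M c f : cbn m M f -> cbn m M (fun x => f (x + c)).
Proof.
elim: m f => [|m IH] f [fM df]; first by split.
split=> // i; have [fd cf] := df i; split; last by rewrite partial_translate; apply: IH.
move=> x; have := fd (x + c); rewrite /derivable => H.
suff -> : (fun h : R => h^-1 *: (((fun y => f (y + c)) \o shift x) (h *: evec R i) - f (x + c)))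
  = (fun h => h^-1 *: ((f \o shift (x + c)) (h *: evec R i) - f (x + c))) by [].
by apply/funext => h /=; rewrite addrA.
Qed.

Definition cbnv m M v := forall i, cbn m M (comp i v).
Definition CBv v := forall i, CB (comp i v).

Lemma CB_family k (F : 'I_k -> 'rV[R]_n -> R) :
  (forall i, CB (F i)) -> forall m, exists2 M, 0 <= M & forall i, cbn m M (F i).
Proof.
move=> cF m; have /(_ _)/cid := fun i => cF i m.
move=> /all_sig[M cM]; exists (\sum_i `|M i|) => [|i].
  by rewrite sumr_ge0.
apply: cbnW (cM i) => //.
by rewrite (le_trans (ler_norm _)) // (bigD1 i) //= lerDl sumr_ge0.
Qed.

Lemma CBv_bound v : CBv v -> forall m, exists2 M, 0 <= M & cbnv m M v.
Proof. by move=> cv m; have [M M0 cM] := @CB_family _ (fun i => comp i v) cv m; exists M. Qed.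

Lemma cbnv_bound m M v x : 0 <= M -> cbnv m M v -> `|v x| <= M.
Proof. by move=> M0 cv; apply: rv_norm_le => // i; exact: (cbn_bound _ (cv i)). Qed.

Lemma cbnv_lip M v x y : 0 <= M -> cbnv 1 M v -> `|v x - v y| <= n%:R * M * `|x - y|.
Proof.
move=> M0 cv; apply: rv_norm_le => [|i]; first by rewrite !mulr_ge0.
by rewrite !mxE; exact: (cbn_lip _ _ (cv i)).
Qed.

Lemma cbnvW m m' M M' v : (m' <= m)%N -> M <= M' -> cbnv m M v -> cbnv m' M' v.
Proof. by move=> mm MM cv i; exact: cbnW (cv i). Qed.

Lemma cbn_taylor_line M f x i h : cbn 2 M f ->
  `|f (x + h *: evec R i) - f x - h * partial i f x| <= 2 * n%:R ^+ 2 * M * h ^+ 2.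
Proof.
move=> cf; have := cbn_taylor x (h *: evec R i) cf.
rewrite normrZ evec_norm mulr1 real_normK ?num_real // (bigD1 i) //= big1 => [|j ji].
  by rewrite !mxE !eqxx /= mulr1 addr0.
by rewrite !mxE /= (negbTE ji) mulr0 mul0r.
Qed.

(** The inner argument moves by [a], the sum of h e_i and t (v q - v x), of size at most [L * |h|].
    Taylor expansion of [g] at [p] and of [v] at [x] leaves two remainders of order h^2, whose
    constants make up [C]. *)
Lemma is_derive_comp_id_add t v g x i : CB g -> CBv v ->
  is_derive x (evec R i) (fun x => g (x + t *: v x))
    (partial i g (x + t *: v x) +
     t * \sum_l partial l g (x + t *: v x) * partial i (comp l v) x).
Proof.
move=> cg cv.
have [G cG] := cg 2%N; have G0 := cbn_ge0 cG; have [K K0 cK] := CBv_bound cv 2.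
set p := x + t *: v x; set D := (X in is_derive _ _ _ X).
pose L := 1 + `|t| * (n%:R * K).
pose C := 2 * n%:R ^+ 2 * G * L ^+ 2 + `|t| * (n%:R * (G * (2 * n%:R ^+ 2 * K))).
apply: (@is_derive_quadratic _ _ _ _ _ _ C) => h _.
set q := x + h *: evec R i; pose a := (q + t *: v q) - p.
have aE : a = h *: evec R i + t *: (v q - v x).
  by rewrite /a /p /q scalerBr; set A := t *: v _; set B := t *: v x;
     rewrite opprD addrACA (addrC x) addrK.
have L0 : 0 <= L by rewrite addr_ge0 // !mulr_ge0.
have aL : `|a| <= L * `|h|.
  rewrite aE; apply: le_trans (ler_normD _ _) _.
  rewrite !normrZ evec_norm mulr1 mulrDl mul1r lerD // -mulrA ler_wpM2l //.
  have := @cbnv_lip K v q x K0 (cbnvW _ (lexx _) cK); move=> /(_ isT).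
  by rewrite /q (addrC x) addrK normrZ evec_norm mulr1.
have -> : q + t *: v q = p + a by rewrite /a subrKC.
have -> : g (p + a) - g p - h * D =
   (g (p + a) - g p - \sum_l a 0 l * partial l g p) +
   t * \sum_l partial l g p * (comp l v q - comp l v x - h * partial i (comp l v) x).
  have -> : \sum_l a 0 l * partial l g p = h * partial i g p +
      t * \sum_l partial l g p * (comp l v q - comp l v x).
    rewrite aE; under eq_bigr => l _ do rewrite mxE mulrDl.
    rewrite big_split /=; congr (_ + _).
      rewrite (bigD1 i) //= big1 ?addr0 => [|j ji]; rewrite !mxE ?eqxx ?mulr1 //=.
      by rewrite (negbTE ji) mulr0 mul0r.
    rewrite mulr_sumr; apply: eq_bigr => l _; rewrite !mxE /comp; ring.
  have -> : \sum_l partial l g p * (comp l v q - comp l v x - h * partial i (comp l v) x)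
     = \sum_l partial l g p * (comp l v q - comp l v x) -
       h * \sum_l partial l g p * partial i (comp l v) x.
    rewrite mulr_sumr -sumrB; apply: eq_bigr => l _; ring.
  rewrite /D; ring.
apply: le_trans (ler_normD _ _) _; rewrite mulrDl lerD //.
  apply: le_trans (cbn_taylor _ _ cG) _; rewrite -[leRHS]mulrA ler_wpM2l //.
    by rewrite !mulr_ge0.
  rewrite -[h ^+ 2]real_normK ?num_real // -exprMn.
  by rewrite lerXn2r ?nnegrE ?mulr_ge0.
rewrite normrM -[leRHS]mulrA ler_wpM2l //.
apply: le_trans (ler_norm_sum _ _ _) _.
apply: le_trans (ler_sum _
  (_ : forall l, _ -> _ <= G * (2 * n%:R ^+ 2 * K * h ^+ 2))) _ => [l _|].
  rewrite normrM ler_pM //; first exact: cbn_bound (cbn_partial l cG).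
  exact: cbn_taylor_line (cK l).
by rewrite sumr_const card_ord -[leLHS]mulr_natl !mulrA.
Qed.

(* Composition with a near-identity map is a linear operator of norm
   [1 + O(t)] on C^m, which is what keeps the Euler iterates bounded in C^m. *)
Lemma cbn_comp_id_add m K : 0 <= K -> exists2 C, 0 <= C &
  forall v t g G, CB g -> CBv v -> cbnv m K v -> 0 <= t <= 1 -> cbn m G g ->
    cbn m ((1 + C * t) * G) (fun x => g (x + t *: v x)).
Proof.
move=> K0; elim: m => [|m [C C0 IH]].
  exists 0 => // v t g G _ _ _ _ cg.
  by rewrite mul0r addr0 mul1r; split=> // x; exact: (cbn_bound _ cg).
(* The second summand accounts for the n products of partial derivatives in the chain rule;
   [1 + C * t] is replaced there by [1 + C], which keeps the constant independent of t. *)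
exists (C + n%:R * (2 ^+ m * ((1 + C) * K))).
  by rewrite !(addr_ge0, mulr_ge0, exprn_ge0).
move=> v t g G Cg Cv cv t01 cg; have G0 := cbn_ge0 cg; move: (t01) => /andP[t0 t1].
apply: cbnS_intro => [x|i x|i].
- apply: le_trans (cbn_bound _ cg) _; rewrite ler_peMl // lerDl mulr_ge0 //.
  by rewrite !(addr_ge0, mulr_ge0, exprn_ge0).
- exact: is_derive_comp_id_add.
have cv' : cbnv m K v by exact: cbnvW cv.
have cp l : cbn m ((1 + C * t) * G) (fun x => partial l g (x + t *: v x)).
  by apply: IH => //; [exact: CB_partial|exact: cbn_partial].
have cs : cbn m (n%:R * (2 ^+ m * ((1 + C * t) * G * K)))
    (fun x => \sum_l partial l g (x + t *: v x) * partial i (comp l v) x).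
  by apply: cbn_sum => l; apply: cbnM => //; exact: (cbn_partial i (cv l)).
apply: cbnW (cbnD (cp i) (cbnZ t cs)) => //.
rewrite (ger0_norm t0) [leRHS]mulrC.
have -> : (1 + C * t) * G + t * (n%:R * (2 ^+ m * ((1 + C * t) * G * K))) =
   G * (1 + (C + n%:R * (2 ^+ m * ((1 + C * t) * K))) * t) by ring.
rewrite ler_wpM2l // lerD2l ler_wpM2r // lerD2l !ler_wpM2l ?exprn_ge0 //.
by rewrite ler_wpM2r // lerD2l ler_piMr.
Qed.

Lemma CB_comp_id_add t v g : CB g -> CBv v -> 0 <= t <= 1 -> CB (fun x => g (x + t *: v x)).
Proof.
move=> cg cv t01 m; have [G cG] := cg m; have [K K0 cK] := CBv_bound cv m.
have [C _ /(_ v t g G)] := cbn_comp_id_add m K0.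
by move=> H; exists ((1 + C * t) * G); apply: H.
Qed.

End CbnAlgebra.

(** * Interpolation inequalities *)

Section Interpolation.
Context {R : realType} {n : nat}.
Implicit Types (f g : 'rV[R]_n -> R) (x : 'rV[R]_n) (A B C M h e : R).

(** By the mean value theorem the derivative equals a difference quotient of step h at some point
    within distance h of x; moving back to x costs [h * B]. *)
Lemma landau_kolmogorov A B g i h x : 0 < h ->
  (forall y, `|g y| <= A) -> (forall y, derivable g y (evec R i)) ->
  (forall y, derivable (partial i g) y (evec R i)) ->
  (forall y, `|partial i (partial i g) y| <= B) ->
  `|partial i g x| <= 2 * A / h + h * B.
Proof.
move=> h0 gA dg ddg gB.
have [t th E1] := mvt_line x h dg.
have [s _ E2] := mvt_line x t ddg.
have E : partial i g x = h^-1 * (g (x + h *: evec R i) - g x) -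
    t * partial i (partial i g) (x + s *: evec R i).
  by rewrite E1 mulKf ?gt_eqF // -E2 /partial; ring.
rewrite E; apply: le_trans (ler_normB _ _) _; apply: lerD.
  rewrite normrM normfV (gtr0_norm h0) mulrC ler_wpM2r ?invr_ge0 ?(ltW h0) //.
  by apply: le_trans (ler_normB _ _) _; rewrite mulr2n mulrDl mul1r lerD.
by rewrite normrM ler_pM // (le_trans th) // gtr0_norm.
Qed.

(** The a priori bound [D0] makes the supremum finite, so the self-improving estimate may be applied
    with [D] the supremum itself and half of it absorbed on the left. *)
Lemma bootstrap_half (T : Type) (f : T -> R) (X D0 : R) :
  (forall y, `|f y| <= D0) ->
  (forall D, (forall y, `|f y| <= D) -> forall y, `|f y| <= X + D / 2) ->
  forall y, `|f y| <= 2 * X.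
Proof.
move=> fD0 boot x0.
pose E := [set r | exists y, r = `|f y|]%classic.
have supE : has_sup E.
  by split; [exists `|f x0|, x0|exists D0 => _ [x ->]].
have fS y : `|f y| <= sup E by apply: sup_upper_bound => //; exists y.
have : sup E <= X + sup E / 2.
  by apply: ge_sup => [|_ [x ->]]; [case: supE|exact: boot].
by have := fS x0; lra.
Qed.

(** Induction on p: [landau_kolmogorov] bounds the first derivative by the second, the induction
    hypothesis applied to [partial i g] bounds the second by the first and by higher ones, and the
    first derivative that reappears on the right is absorbed by [bootstrap_half]. *)
Lemma partial_interpolation p : exists2 C, 0 <= C &
  forall g A B i h, 0 < h -> (forall y, `|g y| <= A) -> cbn p.+1 B g ->
  forall x, `|partial i g x| <= C * (A / h + h ^+ p * B).
Proof.
elim: p => [|p [C C0 IH]].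
  exists 1 => // g A B i h h0 gA cg x; rewrite mul1r expr0 mul1r.
  have A0 : 0 <= A by apply: le_trans (gA x).
  apply: le_trans (cbn_bound _ (cbn_partial i cg)) _.
  by rewrite lerDr divr_ge0 // ltW.
(* The inner estimate is used at the coarser scale [l * h], so the reappearing term is
   [D * (C / l)], at most [D / 2]. *)
pose l := 2 * C + 1.
have l0 : 0 < l by rewrite ltr_wpDl // mulr_ge0.
exists (4 + 2 * (C * l ^+ p)) => [|g A B i h h0 gA cg x].
  by rewrite addr_ge0 // !mulr_ge0 // exprn_ge0 // ltW.
have A0 : 0 <= A by apply: le_trans (gA x).
have B0 := cbn_ge0 cg.
have lh0 : 0 < l * h by rewrite mulr_gt0.
pose X := 2 * A / h + h * (C * ((l * h) ^+ p * B)).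
have : `|partial i g x| <= 2 * X.
  apply: (@bootstrap_half _ _ _ B) => [y|D gD y].
    exact: (cbn_bound _ (cbn_partial i cg)).
  have D0 : 0 <= D by apply: le_trans (gD x).
  apply: (@le_trans _ _ (2 * A / h + h * (C * (D / (l * h) + (l * h) ^+ p * B)))).
    apply: landau_kolmogorov => // [z|z|z].
    - exact: cbn_derivable cg.
    - exact: cbn_derivable (cbn_partial i cg).
    - by apply: IH => //; exact: cbn_partial.
  have -> : h * (C * (D / (l * h) + (l * h) ^+ p * B)) =
      h * (C * ((l * h) ^+ p * B)) + D * (C / l).
    by field; rewrite !gt_eqF.
  have : D * (C / l) <= D / 2 by rewrite ler_wpM2l // ler_pdivrMr // /l; lra.
  rewrite /X; lra.
move=> /le_trans; apply; rewrite /X exprMn.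
have -> : 2 * (2 * A / h + h * (C * (l ^+ p * h ^+ p * B))) =
   4 * (A / h) + (2 * (C * l ^+ p)) * (h ^+ p.+1 * B) by rewrite exprS; ring.
have t1 : 0 <= A / h by rewrite divr_ge0 // ltW.
have t2 : 0 <= h ^+ p.+1 * B by rewrite mulr_ge0 // exprn_ge0 // ltW.
have t3 : 0 <= 2 * (C * l ^+ p) by rewrite !mulr_ge0 // exprn_ge0 // ltW.
move: t1 t2 t3; set a := A / h; set b := h ^+ p.+1 * B; set c := 2 * _ => t1 t2 t3.
have := mulr_ge0 t3 t1; have := mulr_ge0 t3 t2; lra.
Qed.

(** Every derivative costs a factor 1/h on the C^0 norm, while the power of h in front of the high
    norm can be prescribed. The order [K] depends on j and q only, which is what allows h to be
    tuned afterwards to A and B. *)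
Lemma cbn_interpolation j q : exists2 C, 0 <= C & exists K : nat,
  forall g A B h, 0 < h <= 1 -> (forall y, `|g y| <= A) -> cbn K B g ->
  cbn j (C * (A / h ^+ j + h ^+ q * B)) g.
Proof.
elim: j => [|j [C C0 [K IH]]].
  exists 1 => //; exists 0%N => g A B h /andP[h0 h1] gA cg; split=> // x.
  rewrite mul1r expr0 divr1; apply: le_trans (gA x) _.
  by rewrite lerDl mulr_ge0 ?(cbn_ge0 cg) // exprn_ge0 // ltW.
(* The exponent is [q + j] because the induction hypothesis divides this bound by [h ^+ j], and
   [h ^+ q] must remain. *)
have [C1 C10 H1] := partial_interpolation (q + j).
exists (1 + C * C1 + C); first by rewrite !(addr_ge0, mulr_ge0).
exists (maxn K.+1 (q + j).+1) => g A B h /andP[h0 h1] gA cg.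
have B0 := cbn_ge0 cg.
have A0 : 0 <= A by apply: le_trans (gA 0).
pose a := A / h ^+ j.+1; pose b := h ^+ q * B.
have a0 : 0 <= a by rewrite divr_ge0 // exprn_ge0 // ltW.
have b0 : 0 <= b by rewrite mulr_ge0 // exprn_ge0 // ltW.
have CC := mulr_ge0 C0 C10.
split=> [x|i].
  apply: le_trans (gA x) _; apply: (@le_trans _ _ a).
    by rewrite ler_peMr // invf_ge1 ?exprn_gt0 // exprn_ile1 // ltW.
  rewrite -/a -/b; have := mulr_ge0 CC a0; have := mulr_ge0 CC b0.
  have := mulr_ge0 C0 a0; have := mulr_ge0 C0 b0; lra.
have cg1 : cbn K.+1 B g by apply: cbnW cg; rewrite ?leq_maxl.
have cg2 : cbn (q + j).+1 B g by apply: cbnW cg; rewrite ?leq_maxr.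
split=> [x|]; first exact: cbn_derivable cg1.
have := IH (partial i g) _ B h _ (H1 g A B i h h0 gA cg2) (cbn_partial i cg1).
rewrite h0 h1 => /(_ isT); apply: cbnW => //.
have -> : C1 * (A / h + h ^+ (q + j) * B) / h ^+ j = C1 * (a + b).
  rewrite /a /b exprD exprS; field.
  by rewrite expf_neq0 !gt_eqF.
rewrite -/a -/b.
have -> : C * (C1 * (a + b) + b) = C * C1 * a + (C * C1 + C) * b by ring.
rewrite mulrDr lerD // ler_wpM2r //; lra.
Qed.

(** First h is fixed so that the contribution of [h * B] is at most e/2, then d so that the
    contribution of [d / h ^+ k] is at most e/2. The same [K] serves all B and e. *)
Lemma cbn_small k : exists K : nat, forall B e, 0 < e -> exists2 d, 0 < d &
  forall g, (forall y, `|g y| <= d) -> cbn K B g -> cbn k e g.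
Proof.
have [C C0 [K H]] := cbn_interpolation k 1.
exists K => B e e0.
pose h := Num.min 1 (e / (2 * (C + 1) * (`|B| + 1))).
have C1 : 0 < C + 1 by rewrite ltr_wpDl.
have B1 : 0 < `|B| + 1 by rewrite ltr_wpDl.
have h0 : 0 < h by rewrite lt_min ltr01 divr_gt0 // !mulr_gt0.
have h1 : h <= 1 by rewrite ge_min lexx.
have hB : h * (2 * (C + 1) * (`|B| + 1)) <= e.
  by rewrite -ler_pdivlMr ?ge_min ?lexx ?orbT // !mulr_gt0.
exists (e * h ^+ k / (2 * (C + 1))).
  by rewrite divr_gt0 // mulr_gt0 // exprn_gt0.
move=> g gd cg; have B0 := cbn_ge0 cg.
have := H g _ B h _ gd cg; rewrite h0 h1 => /(_ isT); apply: cbnW => //.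
have -> : e * h ^+ k / (2 * (C + 1)) / h ^+ k = e / (2 * (C + 1)).
  by field; rewrite expf_neq0 !gt_eqF.
rewrite expr1 mulrDr.
have t1 : C * (e / (2 * (C + 1))) <= e / 2.
  have -> : e / (2 * (C + 1)) = e / 2 / (C + 1) by field; rewrite gt_eqF.
  rewrite mulrCA ler_piMr ?divr_ge0 ?(ltW e0) // ler_pdivrMr //; lra.
have t2 : C * (h * B) <= e / 2.
  have : h * B * C <= h * (`|B| + 1) * (C + 1).
    rewrite ler_pM ?mulr_ge0 ?(ltW h0) // ?lerDl // ler_wpM2l ?(ltW h0) //.
    by rewrite (ger0_norm B0) lerDl.
  have -> : h * (`|B| + 1) * (C + 1) = h * (2 * (C + 1) * (`|B| + 1)) / 2 by field.
  have -> : C * (h * B) = h * B * C by ring.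
  lra.
lra.
Qed.

Lemma nth_root j e : 0 < e -> exists2 h, 0 < h & h ^+ j.+1 = e.
Proof.
move=> e0; exists (e `^ (j.+1%:R^-1)); first exact: powR_gt0.
rewrite -powR_mulrn ?powR_ge0 // -powRrM mulVf ?powRr1 ?ltW //.
Qed.

(* Convergence at rate [e] in C^0 beats a blow-up like [1 / e] of every
   higher norm. *)
Lemma cbn_rate k : exists K : nat, forall a b e, 0 < e -> exists2 d, 0 < d &
  forall t g, 0 < t < d -> (forall y, `|g y| <= a * t) -> cbn K (b / t) g -> cbn k e g.
Proof.
(* With t = h^(2j), A = a t and B = b/t, both terms of A / h^j + h^(3j) B are multiples of h^j.
   Taking j = k + 1 keeps this exponent positive even for k = 0. *)
pose j := k.+1.
have [C C0 [K H]] := cbn_interpolation j (3 * j).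
exists K => a b e e0.
pose d := Num.min 1 (e / (C * (`|a| + `|b|) + 1)).
have X0 : 0 < C * (`|a| + `|b|) + 1 by rewrite ltr_wpDl // mulr_ge0 // addr_ge0.
have d0 : 0 < d by rewrite lt_min ltr01 divr_gt0.
have d1 : d <= 1 by rewrite ge_min lexx.
have dX : d * (C * (`|a| + `|b|) + 1) <= e.
  by rewrite -ler_pdivlMr ?ge_min ?lexx ?orbT.
exists (d ^+ (2 * j)) => [|t g /andP[t0 td] gt cg]; first by rewrite exprn_gt0.
have [h h0 ht] : exists2 h, 0 < h & h ^+ (2 * j) = t.
  by rewrite mul2n -[j.*2]prednK // ; exact: nth_root.
have hd : h < d.
  rewrite ltNge; apply/negP => dh; move: td; rewrite -ht ltNge => /negP; apply.
  by apply: lerXn2r => //; rewrite nnegrE ltW.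
have h1 : h <= 1 by apply: le_trans (ltW hd) d1.
have := H g _ _ h _ gt cg; rewrite h0 h1 => /(_ isT).
apply: cbnW; first by rewrite leqnSn.
have hn0 : h != 0 by rewrite gt_eqF.
have -> : C * (a * t / h ^+ j + h ^+ (3 * j) * (b / t)) = C * (a + b) * h ^+ j.
  rewrite -ht ![(_ * j)%N]mulnC !exprM; have : h ^+ j != 0 by rewrite expf_neq0.
  by move: (h ^+ j) => y y0; field.
apply: (@le_trans _ _ (C * (`|a| + `|b|) * h)).
  apply: (@le_trans _ _ (C * (`|a| + `|b|) * h ^+ j)).
    by rewrite ler_wpM2r ?exprn_ge0 ?(ltW h0) // ler_wpM2l // lerD ?ler_norm.
  rewrite ler_wpM2l ?mulr_ge0 ?addr_ge0 // exprS ler_piMr ?(ltW h0) //.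
  by rewrite exprn_ile1 // ltW.
apply: le_trans dX; rewrite mulrC ler_pM ?(ltW h0) ?(ltW hd) //.
  by rewrite mulr_ge0 // addr_ge0.
by rewrite lerDl.
Qed.

End Interpolation.

(** * Uniform limits of functions bounded in C^m *)

Section UniformLimits.
Context {R : realType}.

Definition ucv (T : Type) (F : nat -> T -> R) (f : T -> R) :=
  forall e, 0 < e -> exists N, forall m x, (N <= m)%N -> `|F m x - f x| <= e.

Lemma ucv_cauchy (T : Type) (F : nat -> T -> R) :
  (forall e, 0 < e -> exists N, forall m p x, (N <= m)%N -> (N <= p)%N ->
     `|F m x - F p x| <= e) -> exists f, ucv F f.
Proof.
move=> FC.
have cv x : cvg (F ^~ x @ \oo)%classic.
  apply/cauchy_cvgP/cauchy_exP => e e0.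
  have e2 : 0 < e / 2 by rewrite divr_gt0.
  have [N HN] := FC _ e2; exists (F N x), N => // m /= Nm.
  rewrite /ball /= /ball_; apply: le_lt_trans (HN N m x (leqnn _) Nm) _.
  by rewrite ltr_pdivrMr // ltr_pMr // ltr1n.
exists (fun x => lim (F ^~ x @ \oo)%classic) => e e0.
have e2 : 0 < e / 2 by rewrite divr_gt0.
have [N HN] := FC _ e2; exists N => m x Nm.
have /cvgrPdist_le/(_ _ e2)[M _ HM] : (F ^~ x @ \oo --> lim (F ^~ x @ \oo))%classic by [].
have := HM (maxn N M) (leq_maxr _ _); have := HN m (maxn N M) x Nm (leq_maxl _ _).
set l := lim _; have := ler_distD (F (maxn N M) x) (F m x) l.
rewrite (distrC l (F _ _)); lra.
Qed.

Context {n : nat}.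
Implicit Types (f g : 'rV[R]_n -> R).

(** The Landau-Kolmogorov inequality makes the partial derivatives uniformly Cauchy. Their limit is
    the derivative of [f] because the Taylor remainder, uniform in the index, passes to the
    limit. *)
Lemma ucv_partial B (F : nat -> 'rV[R]_n -> R) f i :
  (forall m, cbn 2 B (F m)) -> ucv F f ->
  (forall x, derivable f x (evec R i)) /\
  ucv (fun m => partial i (F m)) (partial i f).
Proof.
move=> cF Ff; have B0 := cbn_ge0 (cF 0%N).
have [l Fl] : exists l, ucv (fun m => partial i (F m)) l.
  apply: ucv_cauchy => e e0.
  (* This step makes the second-derivative term at most e/2; a C^0 accuracy of [e * h / 8] for each
     function then makes the other term e/2. *)
  pose h := e / (4 * (B + 1)).
  have B1 : 0 < B + 1 by rewrite ltr_wpDl.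
  have h0 : 0 < h by rewrite divr_gt0 // mulr_gt0.
  have d0 : 0 < e * h / 8 by rewrite divr_gt0 // mulr_gt0.
  have [N HN] := Ff _ d0; exists N => m p x Nm Np.
  have cD := cbnB (cF m) (cF p).
  have -> : partial i (F m) x - partial i (F p) x =
     partial i (fun y => F m y - F p y) x.
    rewrite (_ : partial i (fun y => F m y - F p y) =
        fun y => partial i (F m) y - partial i (F p) y) //.
    apply: partialE => y.
    by have := is_deriveB (is_derive_partial y i (cF m)) (is_derive_partial y i (cF p)).
  apply: le_trans (landau_kolmogorov (A := 2 * (e * h / 8)) (B := B + B) x h0 _ _ _ _) _.
  - move=> y; have := ler_distD (f y) (F m y) (F p y).
    by rewrite (distrC (f y) (F _ _)); have := HN m y Nm; have := HN p y Np; lra.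
  - by move=> y; exact: cbn_derivable cD.
  - by move=> y; exact: cbn_derivable (cbn_partial i cD).
  - by move=> y; exact: (cbn_bound _ (cbn_partial i (cbn_partial i cD))).
  have -> : 2 * (2 * (e * h / 8)) / h = e / 2 by field; rewrite gt_eqF.
  have : h * (B + B) <= e / 2.
    have -> : e / 2 = h * (2 * (B + 1)) by rewrite /h; field; rewrite gt_eqF.
    by rewrite ler_wpM2l ?(ltW h0) //; lra.
  lra.
have fl x : is_derive x (evec R i) f (l x).
  apply: (@is_derive_quadratic _ _ _ _ _ _ (2 * n%:R ^+ 2 * B)) => h h1.
  apply/ler_addgt0Pr => e e0.
  have e3 : 0 < e / 3 by rewrite divr_gt0.
  have [N1 H1] := Ff _ e3; have [N2 H2] := Fl _ e3.
  have := H1 (maxn N1 N2) (x + h *: evec R i) (leq_maxl _ _).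
  have := H1 (maxn N1 N2) x (leq_maxl _ _); have := H2 (maxn N1 N2) x (leq_maxr _ _).
  have := cbn_taylor_line x i h (cF (maxn N1 N2)).
  set G := F (maxn N1 N2); set C := 2 * _ * _ * _ => T1 T2 T3 T4.
  have T2' : `|h * (partial i G x - l x)| <= e / 3.
    by rewrite normrM; apply: le_trans T2; rewrite ler_piMl.
  have -> : f (x + h *: evec R i) - f x - h * l x =
     (G (x + h *: evec R i) - G x - h * partial i G x)
     - (G (x + h *: evec R i) - f (x + h *: evec R i)) + (G x - f x)
     + h * (partial i G x - l x) by ring.
  apply: le_trans (ler_normD _ _) _; have := T2'.
  set b1 := `|h * _|; move: b1 => b1 Hb1.
  apply: le_trans (lerD (ler_normD _ _) (lexx _)) _.
  apply: le_trans (lerD (lerD (ler_normB _ _) (lexx _)) (lexx _)) _.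
  lra.
by split=> [x|]; [case: (fl x)|rewrite (partialE fl)].
Qed.

(** The bound survives unchanged, but one order is given up: convergence of first derivatives is
    obtained from bounds on second ones. *)
Lemma cbn_ucv m B (F : nat -> 'rV[R]_n -> R) f :
  (forall k, cbn m.+1 B (F k)) -> ucv F f -> cbn m B f.
Proof.
elim: m F f => [|m IH] F f cF Ff.
  split=> // x; apply/ler_addgt0Pr => e e0; have [N /(_ N x (leqnn _))] := Ff _ e0.
  have := cbn_bound x (cF N); have := ler_distD (F N x) 0 (f x).
  by rewrite !sub0r !normrN; lra.
have c2 k : cbn 2 B (F k) by exact: cbnW (cF k).
split=> [x|i].
  apply/ler_addgt0Pr => e e0; have [N /(_ N x (leqnn _))] := Ff _ e0.
  have := cbn_bound x (cF N); have := ler_distD (F N x) 0 (f x).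
  by rewrite !sub0r !normrN; lra.
have [df Fdf] := ucv_partial i c2 Ff; split=> //.
by apply: IH Fdf => k; exact: cbn_partial.
Qed.

(* A family with C^0-modulus [a (t + s)] whose higher norms blow up at most
   like [1 / t] is nevertheless bounded in C^k along a geometric sequence
   [t = r ^ p]: the interpolated increments are summable. *)
Lemma cbn_geometric k : exists K : nat, exists2 r : R, 0 < r < 1 &
  forall a b : R, exists M, forall F : R -> 'rV[R]_n -> R,
    (forall t s x, 0 < t <= 1 -> 0 < s <= 1 -> `|F t x - F s x| <= a * (t + s)) ->
    (forall t, 0 < t <= 1 -> cbn K (b / t) (F t)) ->
    forall p, cbn k M (F (r ^+ p)).
Proof.
pose j := k.+1; have [C C0 [K H]] := @cbn_interpolation R n j (3 * j).
(* At time t = r^p the interpolation scale is h = w^p, so that t = h^(2j) and consecutive terms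
   differ by at most [D * w ^+ p] in C^j. The quotient by r in [D] comes from the later time
   r^(p+1), where the high norm is larger by 1/r. *)
pose w : R := 2^-1; pose r := w ^+ (2 * j).
have w0 : 0 < w by rewrite invr_gt0.
have w1 : w < 1 by rewrite invf_lt1 // ltr1n.
have r0 : 0 < r by rewrite exprn_gt0.
have r1 : r < 1 by rewrite exprn_ilt1 // ltW.
exists (maxn j K), r; first by rewrite r0 r1.
move=> a b; pose D := C * (2 * `|a| + 2 * `|b| / r).
exists (`|b| + 2 * D) => F Fa Fb p.
have D0 : 0 <= D by rewrite mulr_ge0 // addr_ge0 ?divr_ge0 ?mulr_ge0 // ltW.
have rp q : 0 < r ^+ q <= 1.
  by rewrite exprn_gt0 // exprn_ile1 // ltW.
(* The invariant is the partial sum of the geometric series of the increments [D * w ^+ q], q < p,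
   with w = 1/2. *)
suff : cbn j (`|b| + 2 * D * (1 - w ^+ p)) (F (r ^+ p)).
  apply: cbnW; first exact: leqnSn.
  have : 0 <= D * w ^+ p by rewrite mulr_ge0 // exprn_ge0 // ltW.
  by lra.
have Fb' t : 0 < t <= 1 -> cbn (maxn j K) (`|b| / t) (F t).
  move=> t01; apply: cbnW (Fb t t01) => //.
  by rewrite ler_wpM2r ?ler_norm // invr_ge0 ltW //; case/andP: t01.
elim: p => [|p IH].
  apply: cbnW (Fb' _ (rp 0%N)); rewrite ?leq_maxl // !expr0 subrr mulr0 addr0 divr1.
  exact: lexx.
have cD : cbn j (D * w ^+ p) (fun x => F (r ^+ p.+1) x - F (r ^+ p) x).
  have rp0 : 0 < r ^+ p by rewrite exprn_gt0.
  have wp0 : 0 < w ^+ p by rewrite exprn_gt0.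
  have wp1 : w ^+ p <= 1 by rewrite exprn_ile1 // ltW.
  have cK : cbn K (2 * `|b| / (r ^+ p * r)) (fun x => F (r ^+ p.+1) x - F (r ^+ p) x).
    apply: cbnW (leq_maxr j K) _ (cbnB (Fb' _ (rp p.+1)) (Fb' _ (rp p))).
    rewrite exprSr (_ : 2 * `|b| / _ = `|b| / (r ^+ p * r) + `|b| / (r ^+ p * r)); last by ring.
    rewrite lerD2l.
    by rewrite ler_wpM2l // lef_pV2 ?posrE ?mulr_gt0 // ler_piMr // ltW.
  have gA x : `|F (r ^+ p.+1) x - F (r ^+ p) x| <= 2 * `|a| * r ^+ p.
    apply: le_trans (Fa _ _ x (rp p.+1) (rp p)) _.
    apply: (@le_trans _ _ (`|a| * (r ^+ p.+1 + r ^+ p))).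
      by rewrite ler_wpM2r ?ler_norm // addr_ge0 // exprn_ge0 // ltW.
    rewrite (_ : 2 * `|a| * r ^+ p = `|a| * (r ^+ p + r ^+ p)); last by ring.
    rewrite ler_wpM2l // lerD2r.
    by rewrite exprS ler_piMl // ltW.
  have := H _ _ _ (w ^+ p) _ gA cK; rewrite wp0 wp1 => /(_ isT); apply: cbnW => //.
  have -> : C * (2 * `|a| * r ^+ p / (w ^+ p) ^+ j +
      (w ^+ p) ^+ (3 * j) * (2 * `|b| / (r ^+ p * r))) = D * (w ^+ p) ^+ j.
    have rE : r ^+ p = (w ^+ p) ^+ (2 * j) by rewrite -!exprM mulnC.
    rewrite rE /D ![(_ * j)%N]mulnC !exprM.
    have : w ^+ p ^+ j != 0 by rewrite expf_neq0 // gt_eqF.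
    have : r != 0 by rewrite gt_eqF.
    by move: (w ^+ p ^+ j) (r) => y z y0 z0; field; rewrite y0 z0.
  by rewrite ler_wpM2l // exprS ler_piMr ?exprn_ile1 // ltW.
have -> : F (r ^+ p.+1) = fun x => F (r ^+ p) x + (F (r ^+ p.+1) x - F (r ^+ p) x).
  by apply/funext => x; rewrite subrKC.
apply: cbnW (cbnD IH cD) => //; rewrite [w ^+ p.+1]exprS.
have -> : w = 1 / 2 by rewrite /w div1r.
by lra.
Qed.

End UniformLimits.

(** * Almost periodicity *)

Section AlmostPeriodic.
Context {R : realType} {n : nat}.
Implicit Types (f g : 'rV[R]_n -> R) (u v w : 'rV[R]_n -> 'rV[R]_n) (x c : 'rV[R]_n).

Lemma pd_rcons (s : seq 'I_n) i f : pd (rcons s i) f = pd s (partial i f).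
Proof. by rewrite /pd foldr_rcons. Qed.

Lemma pd_translate (s : seq 'I_n) c f : pd s (translate c f) = translate c (pd s f).
Proof. by elim: s => //= i s ->; exact: partial_translate. Qed.

Lemma cbn_pd (s : seq 'I_n) m M f : cbn (size s + m) M f -> cbn m M (pd s f).
Proof.
elim/last_ind: s f => // s i IH f.
by rewrite pd_rcons size_rcons addSn => /(cbn_partial i)/IH.
Qed.

Lemma cbn_pd_bound (s : seq 'I_n) m M f x :
  (size s <= m)%N -> cbn m M f -> `|pd s f x| <= M.
Proof.
move=> sm cf; have : cbn 0 M (pd s f) by apply: cbn_pd; apply: cbnW cf; rewrite ?addn0.
exact: cbn_bound.
Qed.

Lemma pdB (s : seq 'I_n) f g : CB f -> CB g ->
  pd s (fun x => f x - g x) = fun x => pd s f x - pd s g x.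
Proof.
elim/last_ind: s f g => // s i IH f g cf cg.
rewrite !pd_rcons -IH; try exact: CB_partial.
congr (pd s _); apply: partialE => x.
have [M cfM] := cf 1%N; have [N cgN] := cg 1%N.
by have := is_deriveB (is_derive_partial x i cfM) (is_derive_partial x i cgN).
Qed.

Lemma CB_cbn m M f : CB f ->
  (forall s : seq 'I_n, (size s <= m)%N -> forall x, `|pd s f x| <= M) -> cbn m M f.
Proof.
elim: m f => [|m IH] f cf fM.
  by split=> // x; exact: (fM [::]).
split=> [x|i]; first exact: (fM [::]).
split=> [x|]; first exact: CB_derivable.
apply: IH => [|s sm x]; first exact: CB_partial.
by rewrite -pd_rcons; apply: fM; rewrite size_rcons.
Qed.

Lemma Ckb_cbn k f : Ckb k f -> exists M, cbn k M f.
Proof.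
elim: k f => [|k IH] f [fd fc].
  by have [_ [M fM]] := fc [::] isT; exists M; split.
have [_ [M fM]] := fc [::] isT.
have /(_ _)/cid cp : forall i, exists M, cbn k M (partial i f).
  move=> i; apply: IH; split=> s sk.
    by move=> j x; rewrite -pd_rcons; apply: fd; rewrite size_rcons.
  by rewrite -pd_rcons; apply: fc; rewrite size_rcons.
move: cp => /all_sig[N cN].
have N0 i : 0 <= N i by exact: cbn_ge0 (cN i).
have M0 : 0 <= M by apply: le_trans (fM 0).
exists (M + \sum_i N i); split=> [x|i].
  by apply: le_trans (fM x) _; rewrite lerDl sumr_ge0.
split=> [x|]; first exact: (fd [::]).
apply: cbnW (cN i) => //; rewrite (bigD1 i) //= addrCA lerDl addr_ge0 //.
by rewrite sumr_ge0.
Qed.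

(** Continuity of a derivative follows from its Lipschitz bound, hence from boundedness one order
    higher; [CB] can therefore ignore continuity. *)
Lemma CB_Ckb k f : CB f -> Ckb k f.
Proof.
move=> cf; split=> s sk.
  move=> i x; have [M cM] := cf (size s + 1)%N.
  exact: cbn_derivable (cbn_pd cM).
have [M /cbn_pd cM] := cf (size s + 1)%N; split; last first.
  by exists M => x; exact: cbn_bound cM.
move=> x; apply/(@cvgrPdist_le _ _ _ (nbhs x) (nbhs_filter x)) => e e0.
have d0 : 0 <= n%:R * M by rewrite mulr_ge0 // (cbn_ge0 cM).
suff: nbhs_ball_ (ball_ Num.Def.normr) x (fun t => `|pd s f x - pd s f t| <= e).
  by move=> /nbhs_normP.
exists (e / (n%:R * M + 1)); first by rewrite /= divr_gt0 // ltr_wpDl.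
move=> y /= /ltW xy; apply: le_trans (cbn_lip _ _ cM) _.
move: xy; rewrite ler_pdivlMr ?ltr_wpDl //; apply: le_trans.
by rewrite mulrC ler_wpM2l // lerDl.
Qed.

(** The closeness relation is left abstract so that finite nets for several maps, several
    components, or scalar functions of the translation vector can be intersected. *)
Definition totally_bounded (P : R -> 'rV[R]_n -> 'rV[R]_n -> Prop) :=
  forall e, 0 < e -> exists cs : seq 'rV[R]_n, forall c,
    exists2 c', c' \in cs & P e c c'.

Definition close_translates u (e : R) c c' :=
  forall x, `|u (x + c) - u (x + c')| <= e.

Lemma close_translates_half u e c c' a : close_translates u (e / 2) c a ->
  close_translates u (e / 2) c' a -> close_translates u e c c'.
Proof.
move=> H1 H2 x; have := H1 x; have := H2 x.
have := ler_distD (u (x + a)) (u (x + c)) (u (x + c')).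
by rewrite (distrC (u (x + c')) (u (x + a))); lra.
Qed.

Definition apv u := totally_bounded (close_translates u).

(** For each pair of centres a common point of the two balls of radius e/2 is chosen as a new
    centre. When there is none, [xget] returns 0, a harmless extra element of the list. *)
Lemma totally_bounded_and (P Q : R -> 'rV[R]_n -> 'rV[R]_n -> Prop) :
  (forall e c c' a, P (e / 2) c a -> P (e / 2) c' a -> P e c c') ->
  (forall e c c' a, Q (e / 2) c a -> Q (e / 2) c' a -> Q e c c') ->
  totally_bounded P -> totally_bounded Q ->
  totally_bounded (fun e c c' => P e c c' /\ Q e c c').
Proof.
move=> Pt Qt tP tQ e e0; have e2 : 0 < e / 2 by rewrite divr_gt0.
have [cs Hcs] := tP _ e2; have [ds Hds] := tQ _ e2.
pose S a b := [set c | P (e / 2) c a /\ Q (e / 2) c b]%classic.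
exists [seq xget 0 (S a b) | a <- cs, b <- ds] => c.
have [a acs Pa] := Hcs c; have [b bds Qb] := Hds c.
exists (xget 0 (S a b)); first by apply/allpairsP; exists (a, b).
have [Pab Qab] : S a b (xget 0 (S a b)) by apply: (@xgetI _ 0 _ c).
by split; [apply: Pt Pa Pab|apply: Qt Qb Qab].
Qed.

Lemma totally_bounded_forall k (P : 'I_k -> R -> 'rV[R]_n -> 'rV[R]_n -> Prop) :
  (forall i e c c' a, P i (e / 2) c a -> P i (e / 2) c' a -> P i e c c') ->
  (forall i, totally_bounded (P i)) ->
  totally_bounded (fun e c c' => forall i, P i e c c').
Proof.
elim: k P => [|k IH] P Pt tP.
  by move=> e _; exists [:: 0] => c; exists 0; rewrite ?mem_head // => -[].
have tk : totally_bounded (fun e c c' => P ord0 e c c' /\ forall i, P (lift ord0 i) e c c').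
  apply: totally_bounded_and => //.
  - by move=> e c c' a; exact: Pt.
  - by move=> e c c' a H1 H2 i; apply: Pt (H1 i) (H2 i).
  - by apply: (IH (fun i => P (lift ord0 i))) => [i|i]; [exact: Pt|exact: tP].
move=> e /tk[cs H]; exists cs => c; have [c' c'cs [P0 Pi]] := H c; exists c' => // i.
by case: (unliftP ord0 i) => [j|] ->.
Qed.

(** Differences of translates are bounded in every C^K uniformly in the translations, so by
    [cbn_small] a finite net for the C^0 distance is already one for the C^k distance. From here on
    almost periodicity is checked in C^0 only. *)
Lemma Cinfap_vP u : Cinfap_v u <-> CBv u /\ apv u.
Proof.
split=> [cu|[cu au] i k _].
  have Cu : CBv u.
    move=> i m; have /Ckb_cbn[M cM] := (cu i m.+1 isT).1.
    by exists M; apply: cbnW cM.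
  split=> // e e0.
  have : totally_bounded (fun e c c' => forall i x,
      `|comp i u (x + c) - comp i u (x + c')| <= e).
    apply: (@totally_bounded_forall n (fun i e c c' => forall x,
      `|comp i u (x + c) - comp i u (x + c')| <= e)) => [i e1 c c' a H1 H2 x|i e1 e10].
      have := H1 x; have := H2 x.
      have := ler_distD (comp i u (x + a)) (comp i u (x + c)) (comp i u (x + c')).
      by rewrite (distrC (comp i u (x + c')) (comp i u (x + a))); lra.
    have [cs H] := (cu i 1%N isT).2 e1 e10; exists cs => c.
    by have [c' c'cs /(_ [::])H'] := H c; exists c' => // x; exact: H'.
  move=> /(_ e e0)[cs H]; exists cs => c; have [c' c'cs {}H] := H c; exists c' => // x.
  by apply: rv_norm_le => [|i]; [exact: ltW|have := H i x; rewrite /comp !mxE].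
split; first exact/CB_Ckb.
move=> e e0; have [K HK] := @cbn_small R n k.
have [M cM] := cu i K.
have [d d0 Hd] := HK (M + M) e e0.
have [cs Hcs] := au d d0; exists cs => c; have [c' c'cs Hc] := Hcs c; exists c' => //.
move=> s x sk; rewrite !pd_translate /translate.
have tr z : CB (fun y => comp i u (y + z)).
  by move=> m; have [N cN] := cu i m; exists N; exact: cbn_translate.
have -> : pd s (comp i u) (x + c) - pd s (comp i u) (x + c') =
   pd s (fun y => comp i u (y + c) - comp i u (y + c')) x.
  rewrite pdB //; congr (_ - _).
    by rewrite -[RHS]/(pd s (translate c (comp i u)) x) pd_translate.
  by rewrite -[RHS]/(pd s (translate c' (comp i u)) x) pd_translate.
apply: (cbn_pd_bound _ sk); apply: Hd.
  move=> y; apply: le_trans (Hc y); have := rv_entry (u (y + c) - u (y + c')) i.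
  by rewrite !mxE.
by apply: cbnB; exact: cbn_translate.
Qed.

Lemma apv_close u w :
  (forall e, 0 < e -> exists2 d, 0 < d & forall c c',
     close_translates u d c c' -> close_translates w e c c') ->
  apv u -> apv w.
Proof.
move=> H au e /H[d d0 {}H]; have [cs Hcs] := au d d0; exists cs => c.
by have [c' c'cs /H] := Hcs c; exists c'.
Qed.

Lemma apv_close2 u v w :
  (forall e, 0 < e -> exists2 d, 0 < d & forall c c',
     close_translates u d c c' -> close_translates v d c c' -> close_translates w e c c') ->
  apv u -> apv v -> apv w.
Proof.
move=> H au av e /H[d d0 {}H].
have [cs Hcs] := totally_bounded_and (@close_translates_half u)
  (@close_translates_half v) au av d0.
by exists cs => c; have [c' c'cs [H1 H2]] := Hcs c; exists c' => //; exact: H.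
Qed.

Lemma apv_ucv (F : nat -> 'rV[R]_n -> 'rV[R]_n) w :
  (forall m, apv (F m)) ->
  (forall e, 0 < e -> exists m, forall x, `|F m x - w x| <= e) -> apv w.
Proof.
move=> aF Fg e e0; have e3 : 0 < e / 3 by rewrite divr_gt0.
have [m Hm] := Fg _ e3; have [cs Hcs] := aF m _ e3; exists cs => c.
have [c' c'cs H] := Hcs c; exists c' => // x.
have := H x; have := Hm (x + c); have := Hm (x + c').
have := ler_distD (F m (x + c')) (F m (x + c)) (w (x + c')).
have := ler_distD (F m (x + c)) (w (x + c)) (w (x + c')).
by rewrite (distrC (w (x + c)) (F m (x + c))); lra.
Qed.

Lemma nle_cbnv k w e : CBv w -> nle k w e -> cbnv k e w.
Proof. by move=> cg ge i; apply: CB_cbn => // s sk x; exact: ge. Qed.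

Lemma cbnv_nle k w e : cbnv k e w -> nle k w e.
Proof. by move=> cg i s x sk; exact: cbn_pd_bound sk (cg i). Qed.

Lemma CBv_cst c : CBv (fun=> c).
Proof. by move=> i m; exists `|c 0 i|; exact: cbn_cst. Qed.

Lemma cbnvB m M M' u v : cbnv m M u -> cbnv m M' v -> cbnv m (M + M') (fun x => u x - v x).
Proof.
move=> cu cv i; rewrite (_ : comp i _ = fun x => comp i u x - comp i v x).
  exact: cbnB.
by apply/funext => x; rewrite /comp !mxE.
Qed.

Lemma cbnvD m M M' u v : cbnv m M u -> cbnv m M' v -> cbnv m (M + M') (fun x => u x + v x).
Proof.
move=> cu cv i; rewrite (_ : comp i _ = fun x => comp i u x + comp i v x).
  exact: cbnD.
by apply/funext => x; rewrite /comp !mxE.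
Qed.

Lemma cbnvZ m M (a : R) u : cbnv m M u -> cbnv m (`|a| * M) (fun x => a *: u x).
Proof.
move=> cu i; rewrite (_ : comp i _ = fun x => a * comp i u x).
  exact: cbnZ.
by apply/funext => x; rewrite /comp !mxE.
Qed.

Lemma CBvB u v : CBv u -> CBv v -> CBv (fun x => u x - v x).
Proof.
move=> cu cv i m; have [M cM] := cu i m; have [N cN] := cv i m.
rewrite (_ : comp i _ = fun x => comp i u x - comp i v x).
  by exists (M + N); exact: cbnB.
by apply/funext => x; rewrite /comp !mxE.
Qed.

Lemma CBvD u v : CBv u -> CBv v -> CBv (fun x => u x + v x).
Proof.
move=> cu cv i m; have [M cM] := cu i m; have [N cN] := cv i m.
rewrite (_ : comp i _ = fun x => comp i u x + comp i v x).
  by exists (M + N); exact: cbnD.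
by apply/funext => x; rewrite /comp !mxE.
Qed.

Lemma CBvZ (a : R) u : CBv u -> CBv (fun x => a *: u x).
Proof.
move=> cu i m; have [M cM] := cu i m.
rewrite (_ : comp i _ = fun x => a * comp i u x).
  by exists (`|a| * M); exact: cbnZ.
by apply/funext => x; rewrite /comp !mxE.
Qed.

End AlmostPeriodic.

(** * The exponential as a limit of Euler schemes *)

Section Euler.
Context {R : realType} {n : nat}.
Local Notation V := 'rV[R]_n.
Implicit Types (u v w : V -> V) (x y c : V) (M L t d e : R).

Definition estep t v : V -> V := fun x => x + t *: v x.
Definition euler v (N : nat) : V -> V := iter N (estep N%:R^-1 v).

Definition bounded_lipschitz M L v :=
  [/\ 0 <= M, 0 <= L, forall x, `|v x| <= M &
      forall x y, `|v x - v y| <= L * `|x - y|].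

Definition vucv (F : nat -> V -> V) w :=
  forall e, 0 < e -> exists N, forall m x, (N <= m)%N -> `|F m x - w x| <= e.

(* The value [id] is junk: the limit exists for bounded Lipschitz fields. *)
Definition Exp v : V -> V :=
  if pselect (exists w, vucv (fun N => euler v N.+1) w) is left h then sval (cid h)
  else id.

Lemma ler_eps (a b : R) (C : R) : (forall N : nat, a <= b + C / N.+1%:R) -> a <= b.
Proof.
move=> H; apply/ler_addgt0Pr => e e0.
have C0 : 0 < `|C| + 1 by rewrite ltr_wpDl.
pose N := Num.truncn ((`|C| + 1) / e).
apply: le_trans (H N) _; rewrite lerD2l ler_pdivrMr ?ltr0n //.
rewrite mulrC -ler_pdivrMr // ltW //.
apply: le_lt_trans (_ : (`|C| + 1) / e < _).
  rewrite ler_wpM2r ?invr_ge0 ?(ltW e0) //.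
  by apply: le_trans (ler_norm _) _; rewrite lerDl.
exact: truncnS_gt.
Qed.

Lemma vucv_cauchy (F : nat -> V -> V) :
  (forall e, 0 < e -> exists N, forall m p x, (N <= m)%N -> (N <= p)%N ->
     `|F m x - F p x| <= e) -> exists w, vucv F w.
Proof.
move=> FC.
have /(_ _)/cid cF i : exists f, ucv (fun m x => F m x 0 i) f.
  apply: ucv_cauchy => e e0; have [N HN] := FC e e0; exists N => m p x Nm Np.
  by apply: le_trans (HN m p x Nm Np); have := rv_entry (F m x - F p x) i; rewrite !mxE.
exists (fun x => \row_i sval (cF i) x) => e e0.
have /(_ _)/cid Ne i : exists N, forall m x, (N <= m)%N -> `|F m x 0 i - sval (cF i) x| <= e.
  by have := svalP (cF i) e e0.
exists (\max_i sval (Ne i)) => m x Nm; apply: rv_norm_le => [|i]; first exact: ltW.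
rewrite !mxE; apply: (svalP (Ne i)); apply: leq_trans Nm.
by rewrite (bigD1 i) //= leq_maxl.
Qed.

Lemma estep_lip t M L v x y : 0 <= t -> bounded_lipschitz M L v ->
  `|estep t v x - estep t v y| <= (1 + t * L) * `|x - y|.
Proof.
move=> t0 [_ _ _ vL]; rewrite /estep.
have -> : x + t *: v x - (y + t *: v y) = (x - y) + t *: (v x - v y).
  by rewrite scalerBr opprD addrACA.
apply: le_trans (ler_normD _ _) _; rewrite normrZ (ger0_norm t0) mulrDl mul1r lerD2l.
by rewrite -mulrA ler_wpM2l.
Qed.

Lemma iter_lip k (K : R) (F : V -> V) x y : 0 <= K ->
  (forall x y, `|F x - F y| <= K * `|x - y|) ->
  `|iter k F x - iter k F y| <= K ^+ k * `|x - y|.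
Proof.
move=> K0 FK; elim: k => [|k IH] /=; first by rewrite expr0 mul1r.
by apply: le_trans (FK _ _) _; rewrite exprS -mulrA ler_wpM2l.
Qed.

Lemma iter_stable k (K : R) d (F G : V -> V) x : 1 <= K -> 0 <= d ->
  (forall x, `|F x - G x| <= d) ->
  (forall x y, `|G x - G y| <= K * `|x - y|) ->
  `|iter k F x - iter k G x| <= k%:R * d * K ^+ k.
Proof.
move=> K1 d0 FG GK; have K0 : 0 <= K by apply: le_trans K1.
elim: k => [|k IH] /=; first by rewrite subrr normr0 !mul0r.
apply: le_trans (ler_distD (G (iter k F x)) _ _) _.
apply: (@le_trans _ _ (d + K * (k%:R * d * K ^+ k))).
  by apply: lerD; [exact: FG|apply: le_trans (GK _ _) _; exact: ler_wpM2l].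
rewrite -natr1 exprS.
have -> : (k%:R + 1) * d * (K * K ^+ k) = d * (K ^+ k.+1) + K * (k%:R * d * K ^+ k).
  by rewrite exprS; ring.
by rewrite lerD2r ler_peMr // exprn_ege1.
Qed.

Lemma expR_pow (a : R) k : 0 <= a -> (1 + a / k.+1%:R) ^+ k.+1 <= expR a.
Proof.
move=> a0; have -> : expR a = expR (a / k.+1%:R) ^+ k.+1.
  by rewrite -expRM_natl mulrCA divff ?mulr1 // pnatr_eq0.
rewrite lerXn2r ?nnegrE ?expR_ge0 ?expR_ge1Dx // addr_ge0 // divr_ge0 //.
Qed.

Lemma iter_estep_near k t M L v x : 0 <= t -> bounded_lipschitz M L v ->
  `|iter k (estep t v) x - x| <= k%:R * t * M.
Proof.
move=> t0 [M0 _ vM _]; elim: k => [|k IH] /=; first by rewrite subrr normr0 !mul0r.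
rewrite {1}/estep addrAC; apply: le_trans (ler_normD _ _) _.
rewrite -natr1 2!mulrDl mul1r lerD //.
by rewrite normrZ (ger0_norm t0) ler_wpM2l.
Qed.

(** Consistency of the scheme: along the iterates the field varies by at most L times the distance
    travelled, so the error is quadratic in the total time [k * t]. *)
Lemma iter_estep_first k t M L v x : 0 <= t -> bounded_lipschitz M L v ->
  `|iter k (estep t v) x - (x + (k%:R * t) *: v x)| <= (k%:R * t) ^+ 2 * (L * M).
Proof.
move=> t0 bv; have [M0 L0 vM vL] := bv.
elim: k => [|k IH] /=.
  by rewrite !mul0r scale0r addr0 subrr normr0 expr0n /= mul0r.
set y := iter k _ x in IH *.
have -> : estep t v y - (x + (k.+1%:R * t) *: v x) =
   (y - (x + (k%:R * t) *: v x)) + t *: (v y - v x).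
  rewrite /estep -natr1 mulrDl mul1r scalerDl scalerBr !opprD !addrA.
  by rewrite -!addrA; congr (_ + _); rewrite addrCA; congr (_ + _); rewrite addrCA.
apply: le_trans (ler_normD _ _) _.
apply: (@le_trans _ _ ((k%:R * t) ^+ 2 * (L * M) + t * (L * (k%:R * t * M)))).
  apply: lerD => //; rewrite normrZ (ger0_norm t0) ler_wpM2l //.
  by apply: le_trans (vL _ _) _; rewrite ler_wpM2l // (iter_estep_near k x t0 bv).
rewrite -natr1 -subr_ge0.
have -> : ((k%:R + 1) * t) ^+ 2 * (L * M) -
  ((k%:R * t) ^+ 2 * (L * M) + t * (L * (k%:R * t * M))) =
  t ^+ 2 * (k%:R + 1) * (L * M) by ring.
by rewrite !mulr_ge0 // ?sqr_ge0 // addr_ge0.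
Qed.

Lemma euler_lip N M L v x y : bounded_lipschitz M L v ->
  `|euler v N.+1 x - euler v N.+1 y| <= expR L * `|x - y|.
Proof.
move=> bv; have [M0 L0 _ _] := bv.
have t0 : 0 <= (N.+1%:R : R)^-1 by rewrite invr_ge0.
apply: le_trans (iter_lip N.+1 x y _ (fun x y => estep_lip x y t0 bv)) _.
  by rewrite addr_ge0 // mulr_ge0.
by rewrite ler_wpM2r // mulrC expR_pow.
Qed.

(** The fine steps are grouped into N + 1 blocks, each within s^2 L M of one coarse step of length s
    = 1/(N+1); stability of the coarse scheme adds up these errors. Two arbitrary schemes are then
    compared through their common refinement. *)
Lemma euler_refine k N M L v x : bounded_lipschitz M L v ->
  `|euler v (N.+1 * k.+1) x - euler v N.+1 x| <= L * M * expR L / N.+1%:R.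
Proof.
move=> bv; have [M0 L0 _ _] := bv.
pose t : R := (N.+1 * k.+1)%:R^-1; pose s : R := N.+1%:R^-1.
have t0 : 0 <= t by rewrite invr_ge0.
have s0 : 0 <= s by rewrite invr_ge0.
have kt : k.+1%:R * t = s.
  by rewrite /t /s natrM; field; rewrite !nat1r !pnatr_eq0.
rewrite /euler -/t -/s iterM.
have d0 : 0 <= s ^+ 2 * (L * M) by rewrite !mulr_ge0 // sqr_ge0.
have FG y : `|iter k.+1 (estep t v) y - estep s v y| <= s ^+ 2 * (L * M).
  by rewrite -kt; exact: iter_estep_first.
have K1 : 1 <= 1 + s * L by rewrite lerDl mulr_ge0.
apply: le_trans (iter_stable N.+1 x K1 d0 FG (fun x y => estep_lip x y s0 bv)) _.
have -> : N.+1%:R * (s ^+ 2 * (L * M)) = L * M * s.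
  by rewrite /s; field; rewrite nat1r pnatr_eq0.
rewrite mulrAC ler_wpM2r // ler_wpM2l ?mulr_ge0 // /s mulrC.
exact: expR_pow.
Qed.

Lemma euler_dist N P M L v x : bounded_lipschitz M L v ->
  `|euler v N.+1 x - euler v P.+1 x| <=
    L * M * expR L / N.+1%:R + L * M * expR L / P.+1%:R.
Proof.
move=> bv; apply: le_trans (ler_distD (euler v (N.+1 * P.+1) x) _ _) _.
apply: lerD; first by rewrite distrC; exact: euler_refine.
by rewrite mulnC; exact: euler_refine.
Qed.

Lemma Exp_vucv M L v : bounded_lipschitz M L v -> vucv (fun N => euler v N.+1) (Exp v).
Proof.
move=> bv; have [M0 L0 _ _] := bv.
suff [w wP] : exists w, vucv (fun N => euler v N.+1) w.
  rewrite /Exp; case: pselect => [h|[]]; last by exists w.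
  exact: svalP (cid h).
apply: vucv_cauchy => e e0; pose C := L * M * expR L.
have C0 : 0 <= C by rewrite !mulr_ge0 ?expR_ge0.
exists (Num.truncn (2 * C / e)) => m p x Nm Np.
apply: le_trans (euler_dist m p x bv) _.
have H q : (Num.truncn (2 * C / e) <= q)%N -> C / q.+1%:R <= e / 2.
  move=> Nq; rewrite ler_pdivrMr ?ltr0n // mulrC -ler_pdivrMr ?divr_gt0 //.
  have -> : C / (e / 2) = 2 * C / e by field; rewrite gt_eqF.
  by apply: ltW; apply: lt_le_trans (truncnS_gt _) _; rewrite ler_nat ltnS.
by rewrite [leRHS](splitr e) lerD // H.
Qed.

Lemma Exp_euler N M L v x : bounded_lipschitz M L v ->
  `|Exp v x - euler v N.+1 x| <= L * M * expR L / N.+1%:R.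
Proof.
move=> bv; have [M0 L0 _ _] := bv.
apply/ler_addgt0Pr => e e0.
have [P HP] := Exp_vucv bv e0.
(* The sequence converging to [Exp v] is indexed with a shift by one, so the scheme with
   [N.+1 * P.+1] steps sits at the predecessor. *)
have := HP (N.+1 * P.+1).-1 x; rewrite prednK ?muln_gt0 // => /(_ _)H1.
have {}H1 : `|euler v (N.+1 * P.+1) x - Exp v x| <= e.
  by apply: H1; rewrite -ltnS prednK ?muln_gt0 // leq_pmull.
apply: le_trans (ler_distD (euler v (N.+1 * P.+1) x) _ _) _.
by rewrite addrC; apply: lerD; [exact: euler_refine|rewrite distrC].
Qed.

(** Estimates proved for all Euler schemes pass to the limit. The offsets are 0 for Lipschitz and
    stability bounds, and 0 and [c] for the translation identity. *)
Lemma Exp_limit (a b : V) v w M L M' L' x y :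
  bounded_lipschitz M L v -> bounded_lipschitz M' L' w -> forall r,
  (forall N, `|euler v N.+1 x - a - (euler w N.+1 y - b)| <= r) ->
  `|Exp v x - a - (Exp w y - b)| <= r.
Proof.
move=> bv bw r H; apply: (@ler_eps _ _ (L * M * expR L + L' * M' * expR L')) => N.
have H1 := Exp_euler N x bv; have H2 := Exp_euler N y bw.
have -> : Exp v x - a - (Exp w y - b) = (Exp v x - euler v N.+1 x) -
   (Exp w y - euler w N.+1 y) + (euler v N.+1 x - a - (euler w N.+1 y - b)).
  by apply/rowP => i; rewrite !mxE; ring.
rewrite mulrDl addrC; apply: le_trans (ler_normD _ _) _; rewrite lerD //.
by apply: le_trans (ler_normB _ _) _; rewrite lerD.
Qed.

(** This is [Exp_euler] for the scheme with a single step. The error is quadratic in the field: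
    replacing [v] by r v multiplies [L * M] by r^2. *)
Lemma Exp_first M L v x : bounded_lipschitz M L v ->
  `|Exp v x - (x + v x)| <= L * M * expR L.
Proof.
move=> bv; have := Exp_euler 0 x bv; rewrite invr1 mulr1.
by rewrite /euler /= /estep invr1 scale1r.
Qed.

Lemma Exp_near M L v x : bounded_lipschitz M L v -> `|Exp v x - x| <= M.
Proof.
move=> bv; have [M0 L0 vM _] := bv; apply: (@ler_eps _ _ (L * M * expR L)) => N.
have t0 : 0 <= (N.+1%:R : R)^-1 by rewrite invr_ge0.
have := iter_estep_near N.+1 x t0 bv; rewrite divff ?pnatr_eq0 // mul1r.
move=> H; apply: le_trans (ler_distD (euler v N.+1 x) _ _) _.
by rewrite addrC; apply: lerD => //; exact: Exp_euler.
Qed.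

Lemma Exp_lip M L v x y : bounded_lipschitz M L v ->
  `|Exp v x - Exp v y| <= expR L * `|x - y|.
Proof.
move=> bv; have := @Exp_limit 0 0 v v M L M L x y bv bv.
rewrite !subr0; apply => N; rewrite !subr0; exact: euler_lip bv.
Qed.

Lemma Exp_stable M L M' L' v w d x :
  bounded_lipschitz M L v -> bounded_lipschitz M' L' w ->
  (forall x, `|v x - w x| <= d) -> `|Exp v x - Exp w x| <= expR L * d.
Proof.
move=> bv bw vw; have [M0 L0 vM _] := bv.
have d0 : 0 <= d by apply: le_trans (vw 0).
have := @Exp_limit 0 0 v w M L M' L' x x bv bw.
rewrite !subr0; apply => N; rewrite !subr0 distrC.
pose s : R := N.+1%:R^-1; have s0 : 0 <= s by rewrite invr_ge0.
have FG y : `|estep s w y - estep s v y| <= s * d.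
  rewrite /estep opprD addrACA subrr add0r -scalerBr normrZ (ger0_norm s0).
  by rewrite ler_wpM2l // distrC.
have K1 : 1 <= 1 + s * L by rewrite lerDl mulr_ge0.
have sd0 : 0 <= s * d by rewrite mulr_ge0.
apply: le_trans (iter_stable N.+1 x K1 sd0 FG (fun x y => estep_lip x y s0 bv)) _.
rewrite mulrA divff ?pnatr_eq0 // mul1r mulrC ler_wpM2r // /s mulrC.
exact: expR_pow.
Qed.

Lemma bounded_lipschitzZ M L t v : bounded_lipschitz M L v ->
  bounded_lipschitz (`|t| * M) (`|t| * L) (fun x => t *: v x).
Proof.
move=> [M0 L0 vM vL]; split=> [||x|x y]; rewrite ?mulr_ge0 //.
  by rewrite normrZ ler_wpM2l.
by rewrite -scalerBr normrZ -mulrA ler_wpM2l.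
Qed.

Lemma Exp0 : Exp (fun=> 0 : V) = id.
Proof.
apply/funext => x; apply/eqP; rewrite -subr_eq0 -normr_le0.
have b0 : bounded_lipschitz 0 0 (fun=> 0 : V).
  by split=> // [y|y z]; rewrite ?normr0 // subrr normr0 mul0r.
exact: Exp_near b0.
Qed.

(** The Euler scheme of k v with k N steps is literally the k-fold iterate of the scheme of [v] with
    N steps, since both use the step 1/N. *)
Lemma Exp_iter k M L v : bounded_lipschitz M L v ->
  Exp (fun x => k%:R *: v x) = iter k (Exp v).
Proof.
move=> bv; case: k => [|k].
  by rewrite -[RHS]Exp0; congr Exp; apply/funext => x; rewrite scale0r.
have [M0 L0 _ _] := bv.
have bk := bounded_lipschitzZ k.+1%:R bv; rewrite normr_nat in bk.
apply/funext => x; apply/eqP; rewrite -subr_eq0 -normr_le0.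
set v' := fun x => _ in bk *.
pose D1 := (k.+1%:R * L) * (k.+1%:R * M) * expR (k.+1%:R * L).
pose D2 := L * M * expR L * (expR L) ^+ k.+1.
apply: (@ler_eps _ _ (D1 + k.+1%:R * D2)) => N; rewrite add0r.
have H1 := Exp_euler (N.+1 * k.+1).-1 x bk; rewrite prednK ?muln_gt0 // in H1.
have E : euler v' (N.+1 * k.+1) x = iter k.+1 (euler v N.+1) x.
  rewrite /euler mulnC iterM.
  suff -> : estep (k.+1 * N.+1)%:R^-1 v' = estep N.+1%:R^-1 v by [].
  apply/funext => y; rewrite /estep /v' scalerA; congr (_ + _ *: _).
  by rewrite natrM; field; rewrite !nat1r !pnatr_eq0.
rewrite E in H1.
apply: le_trans (ler_distD _ _ _) (le_trans (lerD H1 (lexx _)) _).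
rewrite mulrDl lerD //.
  apply: ler_wpM2l; first by rewrite !mulr_ge0 ?expR_ge0.
  rewrite lef_pV2 ?posrE ?ltr0n // ler_nat; exact: leq_pmulr.
rewrite distrC; have d0 : 0 <= L * M * expR L / N.+1%:R.
  by rewrite divr_ge0 // !mulr_ge0 ?expR_ge0.
apply: le_trans (iter_stable k.+1 x _ d0 (fun y => Exp_euler N y bv)
  (fun x y => euler_lip N x y bv)) _; first by apply: le_trans (expR_ge1Dx L); rewrite lerDl.
by rewrite /D2 le_eqVlt; apply/orP; left; apply/eqP; ring.
Qed.

End Euler.

(** * Semigroup law, translations, and C^m bounds for [Exp] *)

Section ExpRegularity.
Context {R : realType} {n : nat}.
Local Notation V := 'rV[R]_n.
Implicit Types (u v w : V -> V) (x y c : V) (M L t d e : R).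

Lemma truncn_dist (s : R) N : 0 <= s ->
  `|s - (Num.truncn (s * N.+1%:R))%:R / N.+1%:R| <= N.+1%:R^-1.
Proof.
move=> s0; have N0 : 0 < N.+1%:R :> R by rewrite ltr0n.
have /truncn_itv/andP[] : 0 <= s * N.+1%:R by rewrite mulr_ge0.
set a := Num.truncn _ => a1 a2.
rewrite -(ler_pM2r N0) mulVf ?gt_eqF // -[X in _ * X](ger0_norm (ltW N0)) -normrM.
rewrite mulrBl divfK ?gt_eqF // ger0_norm ?subr_ge0 //.
by rewrite lerBlDr addrC natr1 ltW.
Qed.

(** For s and t replaced by multiples a/N and b/N, the law is additivity of iteration counts by
    [Exp_iter]; stability in the field gives an error O(1/N). Non-negative times are what iteration
    counts can approximate. *)
Lemma Exp_semigroup s t M L v : 0 <= s -> 0 <= t -> bounded_lipschitz M L v ->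
  Exp (fun x => (s + t) *: v x) = Exp (fun x => s *: v x) \o Exp (fun x => t *: v x).
Proof.
move=> s0 t0 bv; have [M0 L0 vM vL] := bv; have bZ r := bounded_lipschitzZ r bv.
apply/funext => x; apply/eqP; rewrite -subr_eq0 -normr_le0.
pose Es := expR (`|s| * L); pose Et := expR (`|t| * L).
pose Est := expR (`|s + t| * L).
apply: (@ler_eps _ _ _ (Est * (2 * M) + Es * (Et * M) + Es * M)) => N; rewrite add0r.
pose r : R := N.+1%:R^-1.
pose a := Num.truncn (s * N.+1%:R); pose b := Num.truncn (t * N.+1%:R).
have sa : `|s - a%:R * r| <= r by exact: truncn_dist.
have tb : `|t - b%:R * r| <= r by exact: truncn_dist.
have near p q z : `|p - q| <= z -> forall y, `|p *: v y - q *: v y| <= z * M.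
  by move=> pq y; rewrite -scalerBl normrZ ler_pM.
pose vr := fun x => r *: v x.
have Er k : Exp (fun x => (k%:R * r) *: v x) = iter k (Exp vr).
  rewrite -(Exp_iter k (bZ r)); congr Exp; apply/funext => y.
  by rewrite scalerA.
have st : `|s + t - (a + b)%:R * r| <= 2 * r.
  rewrite natrD mulrDl opprD addrACA.
  by apply: le_trans (ler_normD _ _) _; rewrite mulr2n mulrDl mul1r lerD.
have H1 := Exp_stable x (bZ (s + t)) (bZ ((a + b)%:R * r)) (near _ _ _ st).
have H2 := Exp_stable x (bZ t) (bZ (b%:R * r)) (near _ _ _ tb).
have H3 y := Exp_stable y (bZ s) (bZ (a%:R * r)) (near _ _ _ sa).
rewrite Er iterD in H1; rewrite Er in H2.
have {}H3 y := H3 y; have := H3 (iter b (Exp vr) x); rewrite Er => {}H3.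
have H4 := Exp_lip (Exp (fun x => t *: v x) x) (iter b (Exp vr) x) (bZ s).
apply: le_trans (ler_distD (iter a (Exp vr) (iter b (Exp vr) x)) _ _) _.
rewrite -addrA mulrDl lerD //.
  by apply: le_trans H1 _; rewrite -/r -/Est le_eqVlt; apply/orP; left; apply/eqP; ring.
rewrite distrC; apply: le_trans (ler_distD (Exp (fun x => s *: v x) (iter b (Exp vr) x)) _ _) _.
rewrite mulrDl lerD //.
  apply: le_trans H4 _; rewrite -/Es -!mulrA ler_wpM2l ?expR_ge0 //.
  by apply: le_trans H2 _; rewrite -/Et (mulrC M).
by apply: le_trans H3 _; rewrite -/Es (mulrC r) mulrA.
Qed.

(** Euler steps commute exactly with translations, so the identity already holds before the
    limit. *)
Lemma Exp_translate c M L v x : bounded_lipschitz M L v ->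
  Exp (fun y => v (y + c)) x = Exp v (x + c) - c.
Proof.
move=> bv; have [M0 L0 vM vL] := bv.
have bc : bounded_lipschitz M L (fun y => v (y + c)).
  split=> // y z; have := vL (y + c) (z + c).
  by rewrite opprD addrACA subrr addr0.
apply/eqP; rewrite -subr_eq0 -normr_le0.
have := @Exp_limit R n 0 c _ _ _ _ _ _ x (x + c) bc bv 0.
rewrite subr0; apply => N; rewrite subr0.
suff -> : euler (fun y => v (y + c)) N.+1 x = euler v N.+1 (x + c) - c.
  by rewrite subrr normr0.
rewrite /euler; move: (N.+1%:R^-1) => r; elim: N.+1 => [|k IH] /=; first by rewrite addrK.
by rewrite IH /estep subrK addrAC.
Qed.

Lemma cbnv_bounded_lipschitz B v : 0 <= B -> cbnv 1 B v -> bounded_lipschitz B (n%:R * B) v.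
Proof.
move=> B0 cv; split=> // [|x|x y]; first by rewrite mulr_ge0.
  exact: (cbnv_bound x B0 cv).
exact: cbnv_lip.
Qed.

Lemma CBv_bounded_lipschitz v : CBv v -> exists M, bounded_lipschitz M (n%:R * M) v.
Proof.
by move=> cv; have [M M0 cM] := CBv_bound cv 1; exists M; exact: cbnv_bounded_lipschitz.
Qed.

(** The innermost step is peeled off: the displacement f_(j+1) is f_j composed with id + s v, plus s
    v, which is affine in f_j with a linear part of norm at most [1 + C * s]. Peeling off the
    outermost step would compose [v] with the iterate, a nonlinear expression in f_j. *)
Lemma iter_estep_cbnv m K : 0 <= K -> exists2 C, 0 <= C & forall v s j,
  CBv v -> cbnv m K v -> 0 <= s <= 1 ->
  CBv (fun x => iter j (estep s v) x - x) /\
  cbnv m (j%:R * s * K * (1 + C * s) ^+ j) (fun x => iter j (estep s v) x - x).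
Proof.
move=> K0; have [C C0 H] := @cbn_comp_id_add R n m K K0.
exists C => // v s j Cv cv s01; have /andP[s0 _] := s01.
have Q0 : 0 <= 1 + C * s by rewrite addr_ge0 // mulr_ge0.
pose f j x := iter j (estep s v) x - x; rewrite -/(f j).
elim: j => [|j [Cf cf]].
  have -> : f 0%N = fun=> 0 by apply/funext => x; rewrite /f /= subrr.
  split; first exact: CBv_cst.
  by move=> i; rewrite !mul0r; have := @cbn_cst R n m 0; rewrite normr0; congr cbn;
    apply/funext => x; rewrite /comp mxE.
have E i : comp i (f j.+1) = fun x => comp i (f j) (x + s *: v x) + s * comp i v x.
  apply/funext => x; rewrite /comp /f iterSr {2}/estep !mxE; ring.
split=> i.
  rewrite E => k; have [P1 c1] := CB_comp_id_add (Cf i) Cv s01 k.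
  have [P2 c2] := Cv i k.
  by exists (P1 + `|s| * P2); apply: cbnD => //; exact: cbnZ.
rewrite E; apply: cbnW (cbnD (H v s _ _ (Cf i) Cv cv s01 (cf i)) (cbnZ s (cv i))) => //.
rewrite (ger0_norm s0) -natr1 exprS.
have -> : (j%:R + 1) * s * K * ((1 + C * s) * (1 + C * s) ^+ j) =
  (1 + C * s) * (j%:R * s * K * (1 + C * s) ^+ j) + s * K * (1 + C * s) ^+ j.+1.
  by rewrite exprS; ring.
by rewrite lerD2l ler_peMr ?mulr_ge0 // exprn_ege1 // lerDl mulr_ge0.
Qed.

Lemma invn_itv N : 0 <= (N.+1%:R : R)^-1 <= 1.
Proof. by rewrite invr_ge0 ler0n invf_le1 ?ltr0n // ler1n. Qed.

Lemma euler_cbnv m K : 0 <= K -> exists2 B, 0 <= B & forall v, CBv v -> cbnv m K v ->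
  forall N, CBv (fun x => euler v N.+1 x - x) /\ cbnv m B (fun x => euler v N.+1 x - x).
Proof.
move=> K0; have [C C0 H] := iter_estep_cbnv m K0.
exists (K * expR C) => [|v Cv cv N]; first by rewrite mulr_ge0 ?expR_ge0.
have [Cf cf] := H v N.+1%:R^-1 N.+1 Cv cv (invn_itv N).
split=> //; apply: cbnvW cf => //.
rewrite divff ?pnatr_eq0 // mul1r ler_wpM2l //; exact: expR_pow.
Qed.

Lemma vucv_ucv (F : nat -> V -> V) w i : vucv F w ->
  ucv (fun m => comp i (F m)) (comp i w).
Proof.
move=> Fw e /Fw[N HN]; exists N => m x /(HN m x); apply: le_trans.
by have := rv_entry (F m x - w x) i; rewrite !mxE.
Qed.

Lemma Exp_disp_ucv M L v i : bounded_lipschitz M L v ->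
  ucv (fun N => comp i (fun x => euler v N.+1 x - x)) (comp i (fun x => Exp v x - x)).
Proof.
move=> bv; apply: (@vucv_ucv (fun N x => euler v N.+1 x - x) (fun x => Exp v x - x)).
move=> e /(Exp_vucv bv)[N HN]; exists N => m x /(HN m x).
by rewrite opprD addrACA opprK addNr addr0.
Qed.

Lemma Exp_cbnv m K : 0 <= K -> exists2 B, 0 <= B & forall v, CBv v -> cbnv m.+1 K v ->
  cbnv m B (fun x => Exp v x - x).
Proof.
move=> K0; have [B B0 H] := euler_cbnv m.+1 K0; exists B => // v Cv cv i.
have [M bv] := CBv_bounded_lipschitz Cv.
apply: cbn_ucv (Exp_disp_ucv i bv) => N.
by have [_] := H v Cv cv N; apply.
Qed.

Lemma Exp_CBv v : CBv v -> CBv (fun x => Exp v x - x).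
Proof.
move=> Cv i m; have [K K0 cK] := CBv_bound Cv m.+1.
by have [B _ /(_ v Cv cK i)] := Exp_cbnv m K0; exists B.
Qed.

Lemma Exp_close_translates v e : CBv v -> 0 < e -> exists2 d, 0 < d & forall c c',
  close_translates v d c c' -> close_translates (fun x => Exp v x - x) e c c'.
Proof.
move=> Cv e0; have [M bv] := CBv_bounded_lipschitz Cv.
exists (e / expR (n%:R * M)) => [|c c' H x]; first by rewrite divr_gt0 ?expR_gt0.
have bt z : bounded_lipschitz M (n%:R * M) (fun y => v (y + z)).
  case: bv => M0 L0 vM vL; split=> // y y'; have := vL (y + z) (y' + z).
  by rewrite opprD addrACA subrr addr0.
have := Exp_stable x (bt c) (bt c') H.
rewrite !(Exp_translate _ _ bv) mulrC divfK ?gt_eqF ?expR_gt0 //.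
by congr (`|_| <= _); apply/rowP => i; rewrite !mxE; ring.
Qed.

Lemma Exp_apv v : CBv v -> apv v -> apv (fun x => Exp v x - x).
Proof. by move=> Cv; apply: apv_close => e; exact: Exp_close_translates. Qed.

Lemma Exp_Cinfap v : Cinfap_v v -> Cinfap_v (fun x => Exp v x - x).
Proof.
move=> /Cinfap_vP[Cv av]; apply/Cinfap_vP; split; first exact: Exp_CBv.
exact: Exp_apv.
Qed.

Lemma comp_CBv u w : CBv u -> CBv (fun x => w x - x) -> CBv (fun x => u (w x)).
Proof.
move=> Cu Cw i; have t01 : 0 <= (1 : R) <= 1 by rewrite ler01 lexx.
have := CB_comp_id_add (Cu i) Cw t01; congr CB; apply/funext => x.
by rewrite scale1r subrKC.
Qed.

Lemma comp_cbnv m G K : 0 <= G -> 0 <= K -> exists2 B, 0 <= B & forall u w,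
  CBv u -> CBv (fun x => w x - x) -> cbnv m G u -> cbnv m K (fun x => w x - x) ->
  cbnv m B (fun x => u (w x)).
Proof.
move=> G0 K0; have [C C0 H] := @cbn_comp_id_add R n m K K0.
exists ((1 + C * 1) * G) => [|u w Cu Cw cu cw i].
  by rewrite mulr_ge0 // addr_ge0 // mulr_ge0.
have t01 : 0 <= (1 : R) <= 1 by rewrite ler01 lexx.
have := H _ 1 _ _ (Cu i) Cw cw t01 (cu i); congr cbn; apply/funext => x.
by rewrite scale1r subrKC.
Qed.

Lemma comp_Cinfap u w :
  Cinfap_v u -> Cinfap_v (fun x => w x - x) -> Cinfap_v (fun x => u (w x)).
Proof.
move=> /Cinfap_vP[Cu au] /Cinfap_vP[Cw aw]; apply/Cinfap_vP; split.
  exact: comp_CBv.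
have [M [M0 L0 uM uL]] := CBv_bounded_lipschitz Cu.
apply: apv_close2 au aw => e e0.
have D0 : 0 < n%:R * M + 1 by rewrite ltr_wpDl.
exists (e / 2 / (n%:R * M + 1)) => [|c c' H1 H2 x]; first by rewrite !divr_gt0.
set p := w (x + c) - (x + c); set q := w (x + c') - (x + c').
(* Writing the argument as [p + x] translated by [c] lets almost periodicity of [u] be used at the
   point [p + x]; the change from [p] to [q] is then a Lipschitz estimate. *)
have -> : w (x + c) = (p + x) + c by rewrite -addrA subrK.
have -> : w (x + c') = (q + x) + c' by rewrite -addrA subrK.
apply: le_trans (ler_distD (u (p + x + c')) _ _) _.
have T1 := H1 (p + x); have T2 := H2 x; rewrite -/p -/q in T2.
set d := e / 2 / _ in T1 T2.
have d0 : 0 <= d by rewrite !divr_ge0 // ltW.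
have T3 := uL (p + x + c') (q + x + c').
rewrite (_ : p + x + c' - (q + x + c') = p - q) in T3; last first.
  by apply/rowP => i; rewrite !mxE; ring.
apply: le_trans (lerD T1 (le_trans T3 (ler_wpM2l L0 T2))) _.
have -> : d + n%:R * M * d = e / 2 by rewrite /d; field; rewrite gt_eqF.
by rewrite ler_pdivrMr // ler_peMr ?(ltW e0) // ler1n.
Qed.

End ExpRegularity.

(** * Jacobian determinants *)

Section Determinant.
Context {R : realType}.

Lemma prod_lip m (a b : 'I_m -> R) (K e : R) : 1 <= K -> 0 <= e ->
  (forall i, `|a i| <= K) -> (forall i, `|b i| <= K) -> (forall i, `|a i - b i| <= e) ->
  `|\prod_i a i - \prod_i b i| <= m%:R * K ^+ m * e.
Proof.
move=> K1 e0; have K0 : 0 <= K by apply: le_trans K1.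
have P k (c : 'I_k -> R) : (forall i, `|c i| <= K) -> `|\prod_i c i| <= K ^+ k.
  move=> cK; rewrite normr_prod; have -> : K ^+ k = \prod_(i < k) K by rewrite prodr_const card_ord.
  by apply: ler_prod => i _; rewrite normr_ge0 cK.
elim: m a b => [|m IH] a b aK bK ab.
  by rewrite !big_ord0 subrr normr0 !mul0r.
rewrite !big_ord_recl.
set A := \prod_(i < m) _; set B := \prod_(i < m) _.
have -> : a ord0 * A - b ord0 * B = a ord0 * (A - B) + (a ord0 - b ord0) * B by ring.
apply: le_trans (ler_normD _ _) _; rewrite !normrM.
apply: (@le_trans _ _ (K * (m%:R * K ^+ m * e) + e * K ^+ m)).
  by apply: lerD; apply: ler_pM => //; [exact: IH|exact: P].
rewrite -natr1.
have -> : (m%:R + 1) * K ^+ m.+1 * e = K * (m%:R * K ^+ m * e) + e * K ^+ m.+1.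
  by rewrite exprS; ring.
by rewrite lerD2l ler_wpM2l // exprS ler_peMl // exprn_ge0.
Qed.

Lemma det_lip n (K : R) : 1 <= K -> exists2 D, 0 <= D & forall (A B : 'M[R]_n) e, 0 <= e ->
  (forall i j, `|A i j| <= K) -> (forall i j, `|B i j| <= K) ->
  (forall i j, `|A i j - B i j| <= e) -> `|\det A - \det B| <= D * e.
Proof.
move=> K1; have K0 : 0 <= K by apply: le_trans K1.
exists (#|{perm 'I_n}|%:R * (n%:R * K ^+ n)) => [|A B e e0 AK BK AB].
  by rewrite !mulr_ge0 // exprn_ge0.
rewrite /determinant -sumrB; apply: le_trans (ler_norm_sum _ _ _) _.
apply: le_trans (ler_sum _ (_ : forall s, _ -> _ <= n%:R * K ^+ n * e)) _ => [s _|].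
  by rewrite -mulrBr normrMsign; apply: prod_lip.
by rewrite sumr_const -[leLHS]mulr_natl !mulrA; exact: lexx.
Qed.

(** It keeps a product of N factors [1 - D/N] above exp(-2 D). *)
Lemma expR_le_1B (x : R) : 0 <= x <= 1 / 2 -> expR (- (2 * x)) <= 1 - x.
Proof.
move=> /andP[x0 x1]; rewrite expRN invf_ple ?posrE ?expR_gt0 //; last by lra.
apply: le_trans (expR_ge1Dx (2 * x)).
rewrite -div1r ler_pdivrMr; last by lra.
by nra.
Qed.

End Determinant.

Lemma eventually_forall (I : finType) (P : I -> nat -> Prop) :
  (forall i, exists N, forall m, (N <= m)%N -> P i m) ->
  exists N, forall m, (N <= m)%N -> forall i, P i m.
Proof.
move=> /(_ _)/cid H; exists (\max_i sval (H i)) => m Nm i.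
by apply: (svalP (H i)); apply: leq_trans Nm; rewrite (bigD1 i) //= leq_maxl.
Qed.

Section ExpDiffeo.
Context {R : realType} {n : nat}.
Local Notation V := 'rV[R]_n.
Implicit Types (u v w : V -> V) (x y c : V) (M L t d e : R).

Lemma jac_estep s (f v : V -> V) x : CBv f -> CBv v ->
  1%:M + jac (fun x => f (x + s *: v x) + s *: v x) x =
  (1%:M + jac f (x + s *: v x)) *m (1%:M + s *: jac v x).
Proof.
move=> Cf Cv; set p := x + s *: v x.
rewrite mulmxDl mul1mx mulmxDr mulmx1 -scalemxAr -addrA; congr (_ + _).
rewrite addrCA; apply/matrixP => i k; rewrite !mxE.
have [M cM] := Cv i 1%N.
have d1 := is_derive_comp_id_add s x k (Cf i) Cv.
have d2 := @is_deriveZ _ _ _ (comp i v) s x _ _ (is_derive_partial x k cM).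
have := @is_deriveD _ _ _ _ _ x _ _ _ d1 d2.
set g := (X in is_derive _ _ X _).
have -> : g = comp i (fun x => f (x + s *: v x) + s *: v x).
  by apply/funext => y; rewrite /g /comp !mxE.
move=> /@derive_val; rewrite -/p /partial /= => ->.
rewrite -addrA; congr (_ + _); rewrite [RHS]addrC; congr (_ * _ + _).
by apply: eq_bigr => l _; rewrite !mxE.
Qed.

(** By the chain rule the Jacobian of the iterate is a product of matrices I + s Dv at successive
    points. Each is within O(s) of the identity, so its determinant is at least [1 - D * s]. *)
Lemma det_iter_estep B : 0 <= B -> exists2 D, 0 <= D & forall v s j x,
  CBv v -> cbnv 1 B v -> 0 <= s <= 1 -> D * s <= 1 ->
  (1 - D * s) ^+ j <= \det (1%:M + jac (fun x => iter j (estep s v) x - x) x).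
Proof.
move=> B0; have B1 : 1 <= 1 + B by rewrite lerDl.
have [D D0 HD] := @det_lip R n (1 + B) B1.
exists (D * B) => [|v s j x Cv cv s01 Ds]; first by rewrite mulr_ge0.
have /andP[s0 s1] := s01.
have [C0 _ C] := @iter_estep_cbnv R n 1 B B0.
have Cf k : CBv (fun x => iter k (estep s v) x - x) by have [] := C v s k Cv cv s01.
have one i k : `|(1%:M : 'M[R]_n) i k| <= 1.
  by rewrite mxE; case: eqP => _; rewrite ?normr1 ?normr0.
have jv y i k : `|jac v y i k| <= B.
  by rewrite mxE; exact: (cbn_bound _ (cbn_partial k (cv i))).
have step y : 1 - D * B * s <= \det (1%:M + s *: jac v y).
  have : `|\det (1%:M + s *: jac v y) - \det (1%:M : 'M[R]_n)| <= D * (s * B).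
    apply: HD => [|i k|i k|i k]; first by rewrite mulr_ge0.
    - rewrite mxE; apply: le_trans (ler_normD _ _) _; rewrite lerD //.
      by rewrite mxE normrM (ger0_norm s0) (le_trans (ler_piMl _ s1)).
    - by apply: le_trans (one i k) _.
    - rewrite mxE addrAC subrr add0r mxE normrM (ger0_norm s0) ler_wpM2l //.
  by rewrite det1 ler_norml => /andP[]; lra.
elim: j x => [|j IH] x.
  have -> : (fun x : V => iter 0 (estep s v) x - x) = fun=> 0.
    by apply/funext => y /=; rewrite subrr.
  have -> : jac (fun=> 0 : V) x = 0.
    apply/matrixP => i k; rewrite !mxE.
    have -> : comp i (fun=> 0 : V) = fun=> 0 by apply/funext => z; rewrite /comp mxE.
    exact: derive_cst.
  by rewrite addr0 det1.
have -> : (fun x => iter j.+1 (estep s v) x - x) =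
  (fun x => (fun y => iter j (estep s v) y - y) (x + s *: v x) + s *: v x).
  apply/funext => y; rewrite iterSr {2}/estep /=; set z := iter j _ _.
  by rewrite opprD addrA subrK.
rewrite (jac_estep s x (Cf j) Cv) det_mulmx exprSr ler_pM //.
  by rewrite exprn_ge0 // subr_ge0.
by rewrite subr_ge0.
Qed.

(** Euler schemes with many steps have determinant at least q = exp(-2 D) everywhere. First
    derivatives of the schemes converge, so half of this bound survives in the limit; the number of
    steps may depend on x, the bound does not. *)
Lemma Exp_det v : CBv v ->
  exists2 m, 0 < m & forall x, m <= \det (1%:M + jac (fun x => Exp v x - x) x).
Proof.
move=> Cv; have [B B0 cB] := CBv_bound Cv 1; have [D D0 HD] := det_iter_estep B0.
have [M bv] := CBv_bounded_lipschitz Cv.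
have [K K0 cK] := CBv_bound Cv 2.
have [B' B'0 HB0] := @euler_cbnv R n 2 K K0; have HB := HB0 v Cv cK.
have [B2 B20 cB2] := CBv_bound (Exp_CBv Cv) 1.
pose Q := 1 + B' + B2.
have Q1 : 1 <= Q by rewrite /Q -addrA lerDl addr_ge0.
have [F F0 HF] := @det_lip R n Q Q1.
pose q := expR (- (2 * D)).
have q0 : 0 < q by exact: expR_gt0.
exists (q / 2) => [|x]; first by rewrite divr_gt0.
pose e := q / 2 / (F + 1).
have F1 : 0 < F + 1 by rewrite ltr_wpDl.
have e0 : 0 < e by rewrite !divr_gt0.
have [N HN] : exists N, forall m, (N <= m)%N -> forall ik : 'I_n * 'I_n,
   `|partial ik.2 (comp ik.1 (fun x => euler v m.+1 x - x)) x -
     partial ik.2 (comp ik.1 (fun x => Exp v x - x)) x| <= e.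
  apply: eventually_forall => -[i k] /=.
  have cF m : cbn 2 B' (comp i (fun x => euler v m.+1 x - x)) by have [_] := HB m; apply.
  have [_ /(_ e e0)[N HN]] := ucv_partial k cF (Exp_disp_ucv i bv).
  by exists N => m; exact: HN.
pose P := maxn N (Num.truncn (2 * D)).
have Psmall : D / P.+1%:R <= 1 / 2.
  rewrite ler_pdivrMr ?ltr0n // mulrC -ler_pdivrMr //.
  have -> : D / (1 / 2) = 2 * D by field.
  apply: ltW; apply: lt_le_trans (truncnS_gt _) _.
  by rewrite ler_nat ltnS leq_maxr.
have H1 : q <= \det (1%:M + jac (fun x => euler v P.+1 x - x) x).
  apply: le_trans (HD v P.+1%:R^-1 P.+1 x Cv cB (invn_itv P) _); last first.
    by apply: le_trans Psmall _; lra.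
  have -> : q = expR (- (2 * (D / P.+1%:R))) ^+ P.+1.
    rewrite -expRM_natl /q; congr expR; field.
    by rewrite nat1r pnatr_eq0.
  rewrite lerXn2r ?nnegrE ?expR_ge0 ?expR_le_1B ?Psmall ?andbT ?divr_ge0 //.
  by rewrite subr_ge0 (le_trans Psmall) // ler_pdivrMr // mul1r ler1n.
have one i k : `|(1%:M : 'M[R]_n) i k| <= 1.
  by rewrite mxE; case: eqP => _; rewrite ?normr1 ?normr0.
have H2 : `|\det (1%:M + jac (fun x => euler v P.+1 x - x) x) -
   \det (1%:M + jac (fun x => Exp v x - x) x)| <= F * e.
  apply: HF => [|i k|i k|i k]; first exact: ltW.
  - rewrite mxE; apply: le_trans (ler_normD _ _) _; rewrite /Q -addrA lerD //.
    rewrite mxE; apply: (@le_trans _ _ B'); last by rewrite lerDl.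
    by have [_ /(_ i)/(cbn_partial k)/(cbn_bound x)] := HB P.
  - rewrite mxE; apply: le_trans (ler_normD _ _) _; rewrite /Q -addrA lerD //.
    rewrite mxE; apply: (@le_trans _ _ B2); last by rewrite lerDr.
    by have /(cbn_partial k)/(cbn_bound x) := cB2 i.
  - have := HN P (leq_maxl _ _) (i, k) => /=; congr (`|_| <= _).
    by rewrite !mxE opprD addrACA subrr add0r.
have : F * e <= q / 2.
  have -> : F * e = q / 2 * (F / (F + 1)) by rewrite /e; field; rewrite gt_eqF.
  by rewrite ler_piMr ?divr_ge0 ?(ltW q0) // ler_pdivrMr // mul1r lerDl.
by move: H2; rewrite ler_norml => /andP[]; lra.
Qed.

Lemma Exp_Diffap v : Cinfap_v v -> Diffap (Exp v).
Proof.
move=> cv; split; first exact: Exp_Cinfap.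
by have [m m0 H] := Exp_det ((Cinfap_vP v).1 cv).1; exists m.
Qed.

End ExpDiffeo.

(** * Flows *)

Section Flow.
Context {R : realType} {n : nat}.
Local Notation V := 'rV[R]_n.
Implicit Types (u v w : V -> V) (x y c : V) (M L t d e : R).

Definition flow v t : V -> V := Exp (fun x => t *: v x).

Lemma CBv_scaled_bound v T m : CBv v -> 0 <= T -> exists2 K, 0 <= K &
  forall t, `|t| <= T -> CBv (fun x => t *: v x) /\ cbnv m K (fun x => t *: v x).
Proof.
move=> Cv T0; have [K K0 cK] := CBv_bound Cv m.
exists (T * K) => [|t tT]; first by rewrite mulr_ge0.
split; first exact: CBvZ.
by apply: cbnvW (cbnvZ t cK) => //; rewrite ler_wpM2r.
Qed.

Lemma flow_cbnv v T m : CBv v -> 0 <= T -> exists2 B, 0 <= B &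
  forall t, `|t| <= T -> CBv (fun x => flow v t x - x) /\ cbnv m B (fun x => flow v t x - x).
Proof.
move=> Cv T0; have [K K0 HK] := CBv_scaled_bound m.+1 Cv T0.
have [B B0 HB] := @Exp_cbnv R n m K K0; exists B => // t /HK[Ct ct].
by split; [exact: Exp_CBv|exact: HB].
Qed.

Lemma field_flow_cbnv v T m : CBv v -> 0 <= T -> exists2 B, 0 <= B &
  forall t, `|t| <= T -> cbnv m B (fun x => v (flow v t x)).
Proof.
move=> Cv T0; have [K K0 HK] := flow_cbnv m Cv T0; have [G G0 cG] := CBv_bound Cv m.
have [B B0 HB] := @comp_cbnv R n m G K G0 K0; exists B => // t /HK[Ct ct].
exact: HB.
Qed.

Lemma CinfapZ v t : Cinfap_v v -> Cinfap_v (fun x => t *: v x).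
Proof.
move=> /Cinfap_vP[Cv av]; apply/Cinfap_vP; split; first exact: CBvZ.
apply: apv_close av => e e0; have t0 : 0 < `|t| + 1 by rewrite ltr_wpDl.
exists (e / (`|t| + 1)) => [|c c' H x]; first by rewrite divr_gt0.
rewrite -scalerBr normrZ; have := H x; rewrite ler_pdivlMr //; apply: le_trans.
by rewrite mulrC ler_wpM2l // lerDl.
Qed.

(** By the semigroup law the increment over time e is a short flow, for which [Exp_first] gives a
    quadratic error. *)
Lemma flow_quotient v M L t e x : bounded_lipschitz M L v -> 0 <= t -> e != 0 ->
  `|e| <= 1 -> 0 <= t + e ->
  `|e^-1 *: (flow v (t + e) x - flow v t x) - v (flow v t x)| <=
   (L * M * expR L + L * M) * `|e|.
Proof.
move=> bv t0 e0 e1 te; have [M0 L0 vM vL] := bv.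
have first r y : 0 <= r <= 1 -> `|flow v r y - (y + r *: v y)| <= L * M * expR L * r ^+ 2.
  move=> /andP[r0 r1]; have := Exp_first y (bounded_lipschitzZ r bv).
  move=> /le_trans; apply; rewrite (ger0_norm r0).
  have -> : r * L * (r * M) = L * M * r ^+ 2 by ring.
  rewrite mulrAC ler_wpM2r ?sqr_ge0 // ler_wpM2l ?mulr_ge0 // ler_expR.
  by rewrite ler_piMl.
have e2 : `|e| ^+ 2 = e ^+ 2 by rewrite real_normK ?num_real.
have en0 : 0 < `|e| by rewrite normr_gt0.
rewrite -(ler_pM2l en0) -normrZ scalerBr scalerA mulfV // scale1r.
rewrite (_ : `|e| * _ = (L * M * expR L + L * M) * `|e| ^+ 2); last by ring.
have [ep|en] := leP 0 e.
  have -> : flow v (t + e) x = flow v e (flow v t x).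
    by rewrite addrC /flow (Exp_semigroup ep t0 bv).
  set y := flow v t x; have := first e y.
  rewrite ep (le_trans (ler_norm e) e1) opprD addrA => /(_ isT) /le_trans; apply.
  by rewrite e2 ler_wpM2r ?sqr_ge0 // lerDl mulr_ge0.
(* For e < 0 the roles are exchanged: the flow runs forward by -e from the earlier point [y] to [z],
   and the field at [y] is traded for the field at [z], at cost O(|e|). *)
have ne0 : 0 <= - e by rewrite oppr_ge0 ltW.
have ne1 : - e <= 1 by rewrite -(ltr0_norm en).
set y := flow v (t + e) x.
have -> : flow v t x = flow v (- e) y.
  have {1}-> : t = - e + (t + e) by ring.
  by rewrite /y /flow (Exp_semigroup ne0 te bv).
set z := flow v (- e) y.
have yz : `|v y - v z| <= L * (M * `|e|).
  apply: le_trans (vL _ _) _; rewrite ler_wpM2l // distrC.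
  by have := Exp_near y (bounded_lipschitzZ (- e) bv); rewrite normrN mulrC.
have -> : y - z - e *: v z = - (z - (y + (- e) *: v y)) + e *: (v y - v z).
  by apply/rowP => i; rewrite !mxE; ring.
apply: le_trans (ler_normD _ _) _; rewrite normrN mulrDl lerD //.
  by have := first (- e) y; rewrite ne0 ne1 sqrrN e2 => /(_ isT).
rewrite normrZ mulrC; apply: le_trans (ler_wpM2r _ yz) _ => //.
by rewrite le_eqVlt; apply/orP; left; apply/eqP; ring.
Qed.

Lemma flow_dist v M L t t0 x : bounded_lipschitz M L v ->
  `|flow v t x - flow v t0 x| <= expR (`|t0| * L) * (M * `|t - t0|).
Proof.
move=> bv; have [M0 L0 vM vL] := bv.
have H y : `|t0 *: v y - t *: v y| <= M * `|t - t0|.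
  by rewrite -scalerBl normrZ distrC mulrC ler_wpM2r.
by rewrite distrC; exact: Exp_stable (bounded_lipschitzZ t0 bv) (bounded_lipschitzZ t bv) H.
Qed.

Lemma flowP v : Cinfap_v v -> is_flow v (flow v).
Proof.
move=> cv; have [Cv av] := (Cinfap_vP v).1 cv.
have [M bv] := CBv_bounded_lipschitz Cv; have [M0 L0 vM vL] := bv.
split.
  rewrite /flow -[RHS](@Exp0 R n); congr Exp; apply/funext => x; exact: scale0r.
split; first by move=> t _; apply: Exp_Diffap; exact: CinfapZ.
exists (fun t x => v (flow v t x)); split.
  move=> t t0; split; first by apply: comp_Cinfap => //; apply: Exp_Cinfap; exact: CinfapZ.
  split=> // k eps eps0.
  (* The error of the quotient is O(|e|) in C^0 by [flow_quotient] and trivially O(1/|e|) in C^K,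
     which is the regime of [cbn_rate]. *)
  have [K HK] := @cbn_rate R n k.
  have T0 : 0 <= t + 1 by rewrite addr_ge0.
  have [B B0 HB] := flow_cbnv K Cv T0; have [G G0 HG] := field_flow_cbnv K Cv T0.
  pose a := n%:R * M * M * expR (n%:R * M) + n%:R * M * M.
  have [d d0 Hd] := HK a (B + B + G) eps eps0.
  exists (Num.min d 1) => [|e e0]; first by rewrite lt_min d0 ltr01.
  rewrite lt_min => /andP[ed e1] te; apply: cbnv_nle => i.
  have en0 : 0 < `|e| by rewrite normr_gt0.
  have tT : `|t| <= t + 1 by rewrite ger0_norm // lerDl.
  have teT : `|t + e| <= t + 1.
    by rewrite ger0_norm // lerD2l (le_trans (ler_norm _)) // ltW.
  apply: (Hd `|e|); first by rewrite en0.
    move=> x; apply: le_trans (flow_quotient x bv t0 e0 (ltW e1) te).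
    exact: (rv_entry (e^-1 *: (flow v (t + e) x - flow v t x) - v (flow v t x)) i).
  have [C1 c1] := HB _ tT; have [C2 c2] := HB _ teT.
  have c3 := HG _ tT.
  have := cbnvB (cbnvZ e^-1 (cbnvB c2 c1)) c3.
  have -> : (fun x => e^-1 *: (flow v (t + e) x - x - (flow v t x - x)) - v (flow v t x)) =
     (fun x => e^-1 *: (flow v (t + e) x - flow v t x) - v (flow v t x)).
    by apply/funext => x; congr (_ *: _ - _); rewrite opprD opprK addrACA addNr addr0.
  move=> /(_ i); apply: cbnW => //.
  rewrite normfV [leRHS]mulrDl [_ * (B + B)]mulrC lerD2l ler_pdivlMr //.
  by rewrite ler_piMr // ltW.
move=> t0 t00 k eps eps0; have [K HK] := @cbn_small R n k.
have T0 : 0 <= t0 + 1 by rewrite addr_ge0.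
have [G G0 HG] := field_flow_cbnv K Cv T0.
have [d d0 Hd] := HK (G + G) eps eps0.
pose C := n%:R * M * (expR (`|t0| * (n%:R * M)) * M).
have C0 : 0 <= C by rewrite !mulr_ge0 ?expR_ge0.
have C1 : 0 < C + 1 by rewrite ltr_wpDl.
exists (Num.min (d / (C + 1)) 1) => [|t tt0]; first by rewrite lt_min ltr01 divr_gt0.
rewrite lt_min => /andP[td t1]; apply: cbnv_nle => i; apply: Hd.
  move=> x; apply: (@le_trans _ _ `|v (flow v t x) - v (flow v t0 x)|).
    exact: (rv_entry (v (flow v t x) - v (flow v t0 x)) i).
  apply: le_trans (vL _ _) _.
  apply: le_trans (ler_wpM2l L0 (flow_dist t t0 x bv)) _.
  have -> : n%:R * M * (expR (`|t0| * (n%:R * M)) * (M * `|t - t0|)) = C * `|t - t0|.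
    by rewrite /C; ring.
  move: td; rewrite ltr_pdivlMr // => /ltW; apply: le_trans.
  by rewrite mulrC ler_wpM2l // lerDl.
have tT : `|t| <= t0 + 1.
  have -> : t = (t - t0) + t0 by rewrite subrK.
  apply: le_trans (ler_normD _ _) _; rewrite addrC lerD //; last exact: ltW.
  by rewrite ger0_norm.
have t0T : `|t0| <= t0 + 1 by rewrite ger0_norm // lerDl.
exact: (cbnvB (HG _ tT) (HG _ t0T)).
Qed.

Lemma is_derive_eps (f : R -> R) (t d : R) :
  (forall eps, 0 < eps -> exists2 delta, 0 < delta & forall e, e != 0 -> `|e| < delta ->
     `|e^-1 * (f (t + e) - f t) - d| <= eps) -> is_derive t 1 f d.
Proof.
move=> H.
have cv : ((fun h => h^-1 *: ((f \o shift t) (h *: 1) - f t)) @ 0^' --> d)%classic.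
  apply/cvgrPdist_le => e e0; have [delta d0 Hd] := H e e0.
  near=> h; rewrite distrC /= [h *: 1]mulr1 [h + t]addrC; apply: Hd.
    by near: h; exact: nbhs_dnbhs_neq.
  by near: h; apply: dnbhs0_lt.
split; last by apply/cvg_lim.
by apply/cvg_ex; exists d.
Unshelve. all: by end_near.
Qed.

Lemma flow_entry_quotient u phi : is_flow u phi -> forall t x i, 0 <= t ->
  forall eps, 0 < eps -> exists2 delta, 0 < delta & forall e, e != 0 -> `|e| < delta ->
   0 <= t + e -> `|e^-1 * (phi (t + e) x 0 i - phi t x 0 i) - u (phi t x) 0 i| <= eps.
Proof.
move=> [_ [_ [dphi [Hd _]]]] t x i t0 eps eps0.
have [_ [Hq E]] := Hd t t0; have [delta d0 {}Hq] := Hq 0%N eps eps0.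
exists delta => // e e0 ed te; have := Hq e e0 ed te i [::] x isT.
by rewrite /= /comp !mxE E.
Qed.

(** Gronwall for [S], the sum of the squared components of the difference: unlike the sup norm it is
    differentiable, and exp(-K t) S(t) is nonincreasing and starts at 0. *)
Lemma flow_unique u phi1 phi2 : CBv u -> is_flow u phi1 -> is_flow u phi2 ->
  forall t, 0 <= t -> phi1 t = phi2 t.
Proof.
move=> Cu f1 f2 T T0; apply/funext => x.
have [M [M0 L0 _ uL]] := CBv_bounded_lipschitz Cu; set L := n%:R * M in L0 uL.
(* Flows are controlled only for t >= 0, but two-sided derivatives are wanted at 0. The extension by
   0 is differentiable there because both flows start at [x], which makes [D i 0] vanish. *)
pose d i t := if 0 <= t then phi1 t x 0 i - phi2 t x 0 i else 0.
pose D i t := u (phi1 t x) 0 i - u (phi2 t x) 0 i.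
have phi0 : phi1 0 x = phi2 0 x by rewrite f1.1 f2.1.
have dd i t : 0 <= t -> is_derive t 1 (d i) (D i t).
  move=> t0; apply: is_derive_eps => eps eps0.
  have e2 : 0 < eps / 2 by rewrite divr_gt0.
  have [d1 d10 H1] := flow_entry_quotient f1 x i t0 e2.
  have [d2 d20 H2] := flow_entry_quotient f2 x i t0 e2.
  (* For t > 0 the radius t keeps [t + e] non-negative; at t = 0 a negative e is allowed and meets
     the zero extension. *)
  exists (Num.min (Num.min d1 d2) (if t == 0 then 1 else t)).
    rewrite !lt_min d10 d20 /=; case: eqP => // /eqP tn0.
    by rewrite lt_neqAle eq_sym tn0.
  move=> e e0; rewrite !lt_min => /andP[/andP[ed1 ed2] et].
  rewrite /d t0; have [te|te] := leP 0 (t + e).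
    have h1 := H1 e e0 ed1 te; have h2 := H2 e e0 ed2 te; rewrite /D.
    rewrite (_ : _ - _ = (e^-1 * (phi1 (t + e) x 0 i - phi1 t x 0 i) - u (phi1 t x) 0 i) -
      (e^-1 * (phi2 (t + e) x 0 i - phi2 t x 0 i) - u (phi2 t x) 0 i)); last by ring.
    by apply: le_trans (ler_normB _ _) _; rewrite [leRHS](splitr eps) lerD.
  have tE : t = 0.
    move: et; case: eqP => // _ et; exfalso.
    by have := ler_norm (- e); rewrite normrN; lra.
  by rewrite /D tE phi0 !subrr mulr0 subrr normr0 ltW.
pose K := 2 * (n%:R * L).
pose S t := \sum_i d i t * d i t.
pose dS t := \sum_i (d i t * D i t + d i t * D i t).
have SD t : 0 <= t -> is_derive t 1 S (dS t).
  move=> t0; have -> : S = \sum_i (d i * d i).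
    by apply/funext => r; rewrite fct_sumE.
  apply: is_derive_sum => i; have := is_deriveM (dd i t t0) (dd i t t0).
  by [].
have S0 t : 0 <= S t by rewrite sumr_ge0 // => i _; rewrite -expr2 sqr_ge0.
have dSK t : 0 <= t -> dS t <= K * S t.
  move=> t0; set p := phi1 t x - phi2 t x.
  have dE i : d i t = p 0 i by rewrite /d t0 !mxE.
  have pS : `|p| ^+ 2 <= S t.
    have : `|p| <= Num.sqrt (S t).
      apply: rv_norm_le => [|i]; first exact: sqrtr_ge0.
      rewrite -sqrtr_sqr ler_sqrt // /S (bigD1 i) //= dE expr2 lerDl.
      by rewrite sumr_ge0 // => j _; rewrite -expr2 sqr_ge0.
    by move=> h; rewrite -[leRHS](sqr_sqrtr (S0 t)) lerXn2r ?nnegrE ?sqrtr_ge0.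
  apply: (@le_trans _ _ (\sum_(i < n) 2 * (L * S t))).
    apply: ler_sum => i _; rewrite (_ : _ + _ = 2 * (d i t * D i t)); last by ring.
    rewrite ler_wpM2l //.
    apply: le_trans (ler_norm _) _; rewrite normrM dE.
    apply: (@le_trans _ _ (`|p| * (L * `|p|))).
      apply: ler_pM => //; first exact: rv_entry.
      apply: le_trans (uL _ _).
      by have := rv_entry (u (phi1 t x) - u (phi2 t x)) i; rewrite !mxE.
    by rewrite mulrCA ler_wpM2l // -expr2.
  rewrite sumr_const card_ord -[leLHS]mulr_natl.
  by rewrite le_eqVlt /K; apply/orP; left; apply/eqP; ring.
pose G t := expR (- (K * t)) * S t.
have GD t : 0 <= t -> is_derive t 1 G (expR (- (K * t)) * dS t - K * expR (- (K * t)) * S t).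
  move=> t0.
  have de : is_derive t 1 (fun r => expR (- (K * r))) (expR (- (K * t)) * - K).
    apply: (@is_derive1_comp _ expR (fun r => - (K * r)) t).
    apply: is_deriveN; have := @is_deriveZ R R R id K t 1 1 (is_derive_id _ _).
    by rewrite /GRing.scale /= mulr1.
  have := is_deriveM de (SD t t0); set v1 := (X in is_derive _ _ _ X).
  suff -> : v1 = expR (- (K * t)) * dS t - K * expR (- (K * t)) * S t by [].
  by rewrite /v1 /GRing.scale /=; ring.
have Gd (t : R) : t \in `]0, T[ -> derivable G t 1.
  by rewrite in_itv /= => /andP[/ltW t0 _]; case: (GD t t0).
have Gle (t : R) : t \in `]0, T[ -> derive1 G t <= 0.
  rewrite in_itv /= => /andP[/ltW t0 _].
  rewrite derive1E (@derive_val _ _ _ _ _ _ _ (GD t t0)).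
  rewrite (_ : _ - _ = expR (- (K * t)) * (dS t - K * S t)); last by ring.
  rewrite pmulr_rle0 ?expR_gt0 // subr_le0.
  exact: dSK.
have Gc : {within `[0, T], continuous G}%classic.
  apply: derivable_within_continuous => t; rewrite in_itv /= => /andP[t0 _].
  by case: (GD t t0).
have GT : G T <= G 0.
  exact: (@ler0_derive1_nincr R G 0 T Gd Gle Gc 0 T (lexx 0) T0 (lexx T)).
have G0 : G 0 = 0.
  rewrite /G /S big1 ?mulr0 // => i _.
  by rewrite /d lexx phi0 subrr mulr0.
have ST : S T = 0.
  apply/eqP; rewrite eq_le S0 andbT -(pmulr_rle0 _ (expR_gt0 (- (K * T)))) -G0.
  exact: GT.
apply/rowP => i; apply/eqP; rewrite -subr_eq0.
have := ST; rewrite /S => /psumr_eq0P H.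
have := H (fun i _ => _) i isT; rewrite /d T0 -expr2 => HH.
rewrite -sqrf_eq0; apply/eqP; apply: HH => j; exact: sqr_ge0.
Qed.

End Flow.

(** * The derivative of the exponential *)

Section DirectionalDerivative.
Context {R : realType} {n : nat}.
Local Notation V := 'rV[R]_n.
Implicit Types (u v w h : V -> V) (x y c : V) (B M L s e : R).

Definition dquot u h e : V -> V :=
  fun x => e^-1 *: (Exp (fun z => u z + e *: h z) x - Exp u x).

(** The limit is taken along e = 1/(N+1) only; [dquot_dExp] shows that it controls all small e. The
    default [id] is not reached when [u] and [h] have bounded derivatives up to order 2. *)
Definition dExp u h : V -> V :=
  if pselect (exists w, vucv (fun N => dquot u h N.+1%:R^-1) w) is left p
  then sval (cid p) else id.

Lemma cbnv_perturb m B u h e : 0 <= B -> cbnv m B u -> cbnv m B h -> `|e| <= 1 ->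
  cbnv m (2 * B) (fun z => u z + e *: h z).
Proof.
move=> B0 cu ch e1; apply: cbnvW (cbnvD cu (cbnvZ e ch)) => //.
by rewrite mulr2n mulrDl mul1r lerD2l ler_piMl.
Qed.

Lemma perturb_bounded_lipschitz B u h e : 0 <= B -> cbnv 1 B u -> cbnv 1 B h ->
  `|e| <= 1 -> bounded_lipschitz (2 * B) (n%:R * (2 * B)) (fun z => u z + e *: h z).
Proof.
move=> B0 cu ch e1; apply: cbnv_bounded_lipschitz; first by rewrite mulr_ge0.
exact: cbnv_perturb.
Qed.

(** Expanding [u] at the common base point [x], the linear parts act on the difference of the two
    quotients, and what remains is quadratic in the displacements. *)
Lemma field_second_difference B u x y z e e' : 0 <= B -> cbnv 2 B u ->
  `|e^-1 *: (u y - u x) - e'^-1 *: (u z - u x)| <=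
  n%:R * B * `|e^-1 *: (y - x) - e'^-1 *: (z - x)| +
  2 * n%:R ^+ 2 * B * (`|e|^-1 * `|y - x| ^+ 2 + `|e'|^-1 * `|z - x| ^+ 2).
Proof.
move=> B0 cu; set w := e^-1 *: (y - x) - e'^-1 *: (z - x).
set T := 2 * n%:R ^+ 2 * B.
have T0 : 0 <= T by rewrite !mulr_ge0 // exprn_ge0.
apply: rv_norm_le => [|i].
  by rewrite addr_ge0 ?mulr_ge0 // ?addr_ge0 ?mulr_ge0 ?invr_ge0 ?exprn_ge0.
pose f := comp i u.
have ty := cbn_taylor x (y - x) (cu i); rewrite subrKC -/f in ty.
have tz := cbn_taylor x (z - x) (cu i); rewrite subrKC -/f in tz.
set Sy := \sum_l _ in ty; set Sz := \sum_l _ in tz.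
have -> : (e^-1 *: (u y - u x) - e'^-1 *: (u z - u x)) 0 i =
   \sum_l w 0 l * partial l f x + (e^-1 * (f y - f x - Sy) - e'^-1 * (f z - f x - Sz)).
  have -> : \sum_l w 0 l * partial l f x = e^-1 * Sy - e'^-1 * Sz.
    rewrite /Sy /Sz !mulr_sumr -sumrB; apply: eq_bigr => l _; rewrite !mxE; ring.
  rewrite !mxE /f /comp; ring.
apply: le_trans (ler_normD _ _) _; apply: lerD.
  apply: le_trans (ler_norm_sum _ _ _) _.
  apply: le_trans (ler_sum _ (_ : forall l, _ -> _ <= B * `|w|)) _ => [l _|].
    rewrite normrM mulrC ler_pM ?rv_entry //.
    exact: (cbn_bound _ (cbn_partial l (cu i))).
  by rewrite sumr_const card_ord -[leLHS]mulr_natl mulrA.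
apply: le_trans (ler_normB _ _) _; rewrite [leRHS]mulrDr !normrM !normfV; apply: lerD.
  by rewrite mulrCA ler_wpM2l ?invr_ge0.
by rewrite mulrCA ler_wpM2l ?invr_ge0.
Qed.

Lemma gronwall_discrete (a : nat -> R) (q b : R) : 1 <= q -> 0 <= b -> a 0%N = 0 ->
  forall N, (forall j, (j < N)%N -> a j.+1 <= q * a j + b) -> a N <= N%:R * b * q ^+ N.
Proof.
move=> q1 b0 a0; have q0 : 0 <= q by apply: le_trans q1.
elim=> [|N IH] H; first by rewrite a0 !mul0r.
apply: le_trans (H N (ltnSn N)) _.
apply: (@le_trans _ _ (q * (N%:R * b * q ^+ N) + b)).
  by rewrite lerD2r ler_wpM2l // IH // => j jN; apply: H; exact: ltnW.
have -> : N.+1%:R * b * q ^+ N.+1 = q * (N%:R * b * q ^+ N) + b * q ^+ N.+1.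
  by rewrite -natr1 exprS; ring.
by rewrite lerD2l ler_peMr // exprn_ege1.
Qed.

(** Along the scheme the perturbed orbit stays within [|r| * E] of the unperturbed one. So the
    quadratic remainders divided by |r|, and the variation of [h] between the two orbits, contribute
    at most a step s times [b] times (|e| + |e'|); the rest is the discrete Gronwall inequality. *)
Lemma euler_second_difference B : 0 <= B -> exists2 C, 0 <= C &
  forall u h e e' N x, cbnv 2 B u -> cbnv 2 B h -> e != 0 -> e' != 0 ->
  `|e^-1 *: (euler (fun z => u z + e *: h z) N.+1 x - euler u N.+1 x) -
    e'^-1 *: (euler (fun z => u z + e' *: h z) N.+1 x - euler u N.+1 x)|
  <= C * (`|e| + `|e'|).
Proof.
move=> B0; pose L := n%:R * B; pose T := 2 * n%:R ^+ 2 * B; pose E := B * expR L.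
have L0 : 0 <= L by rewrite mulr_ge0.
have T0 : 0 <= T by rewrite !mulr_ge0 // exprn_ge0.
have E0 : 0 <= E by rewrite mulr_ge0 ?expR_ge0.
pose b := T * E ^+ 2 + L * E.
have b0 : 0 <= b by rewrite addr_ge0 ?mulr_ge0 ?exprn_ge0.
exists (b * expR L) => [|u h e e' N x cu ch e0 e'0]; first by rewrite mulr_ge0 ?expR_ge0.
pose s : R := N.+1%:R^-1; have s0 : 0 <= s by rewrite invr_ge0.
have bu : bounded_lipschitz B L u by apply: cbnv_bounded_lipschitz => //; exact: cbnvW cu.
have [_ _ hB hL] : bounded_lipschitz B L h.
  by apply: cbnv_bounded_lipschitz => //; exact: cbnvW ch.
pose X j := iter j (estep s u) x.
pose Y r j := iter j (estep s (fun z => u z + r *: h z)) x.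
have q1 : 1 <= 1 + s * L by rewrite lerDl mulr_ge0.
have q0 : 0 <= 1 + s * L by apply: le_trans q1.
have near r j : (j < N.+1)%N -> `|Y r j - X j| <= `|r| * E.
  move=> jN.
  have FG y : `|estep s (fun z => u z + r *: h z) y - estep s u y| <= s * (`|r| * B).
    rewrite /estep opprD addrACA subrr add0r -scalerBr normrZ (ger0_norm s0).
    by rewrite ler_wpM2l // addrAC subrr add0r normrZ ler_wpM2l.
  have d0 : 0 <= s * (`|r| * B) by rewrite !mulr_ge0.
  apply: le_trans (iter_stable j x q1 d0 FG (fun x y => estep_lip x y s0 bu)) _.
  have rB : 0 <= `|r| * B by rewrite mulr_ge0.
  have js : j%:R * s <= 1.
    by rewrite /s ler_pdivrMr ?ltr0n // mul1r ler_nat; exact: ltnW.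
  rewrite /E [leRHS]mulrA mulrA; apply: ler_pM; rewrite ?exprn_ge0 ?mulr_ge0 //.
    by rewrite ler_piMl.
  apply: (@le_trans _ _ ((1 + s * L) ^+ N.+1)).
    by apply: ler_weXn2l => //; exact: ltnW.
  by rewrite /s mulrC; exact: expR_pow.
pose w j := e^-1 *: (Y e j - X j) - e'^-1 *: (Y e' j - X j).
rewrite -[X in `|X|]/(w N.+1).
have w0 : `|w 0%N| = 0 by rewrite /w /X /Y /= !subrr !scaler0 subrr normr0.
have sb0 : 0 <= s * (b * (`|e| + `|e'|)) by rewrite !mulr_ge0 // addr_ge0.
apply: le_trans (@gronwall_discrete (fun j => `|w j|) _ _ q1 sb0 w0 N.+1 _) _; last first.
  rewrite mulrA divff ?pnatr_eq0 // mul1r [leRHS]mulrAC ler_wpM2l ?mulr_ge0 // ?addr_ge0 //.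
  by rewrite /s mulrC; exact: expR_pow.
move=> j jN; have ny := near e j jN; have nz := near e' j jN.
have -> : w j.+1 = w j + s *: ((e^-1 *: (u (Y e j) - u (X j)) -
   e'^-1 *: (u (Y e' j) - u (X j))) + (h (Y e j) - h (Y e' j))).
  apply/rowP => i; rewrite /w /X /Y /= /estep !mxE; field.
  by rewrite e0 e'0.
apply: le_trans (ler_normD _ _) _; rewrite normrZ (ger0_norm s0).
rewrite [(1 + s * L) * _]mulrDl mul1r -[leRHS]addrA lerD2l.
rewrite -[s * L * _]mulrA -mulrDr ler_wpM2l //.
have sd := field_second_difference (X j) (Y e j) (Y e' j) e e' B0 cu.
have quad r : r != 0 -> `|Y r j - X j| <= `|r| * E ->
    `|r|^-1 * `|Y r j - X j| ^+ 2 <= E ^+ 2 * `|r|.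
  move=> r0 H; have rn : 0 < `|r| by rewrite normr_gt0.
  rewrite mulrC ler_pdivrMr //.
  have -> : E ^+ 2 * `|r| * `|r| = (`|r| * E) ^+ 2 by ring.
  by rewrite lerXn2r ?nnegrE // mulr_ge0.
apply: le_trans (ler_normD _ _) _.
apply: le_trans (lerD sd (hL _ _)) _; rewrite -/L -/T -addrA lerD2l.
rewrite [leRHS]mulrDl lerD //.
  by rewrite -mulrA ler_wpM2l // mulrDr lerD // quad.
rewrite -mulrA ler_wpM2l //; apply: le_trans (ler_distD (X j) _ _) _.
by rewrite (distrC (X j)) mulrDr !(mulrC E) lerD.
Qed.

Lemma dquot_second_difference B : 0 <= B -> exists2 C, 0 <= C &
  forall u h e e' x, cbnv 2 B u -> cbnv 2 B h -> e != 0 -> e' != 0 ->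
  `|e| <= 1 -> `|e'| <= 1 -> `|dquot u h e x - dquot u h e' x| <= C * (`|e| + `|e'|).
Proof.
move=> B0; have [C C0 HC] := euler_second_difference B0.
exists C => // u h e e' x cu ch e0 e'0 e1 e'1.
have c1 := (cbnvW (isT : 1 <= 2)%N (lexx B) cu, cbnvW (isT : 1 <= 2)%N (lexx B) ch).
have bu := cbnv_bounded_lipschitz B0 c1.1.
have bl r r1 := @perturb_bounded_lipschitz B u h r B0 c1.1 c1.2 r1.
pose K0 := n%:R * B * B * expR (n%:R * B).
pose K1 := n%:R * (2 * B) * (2 * B) * expR (n%:R * (2 * B)).
(* This constant blows up as e or e' tends to 0, which is harmless: e and e' are fixed while N tends
   to infinity. *)
pose D := `|e|^-1 * (K1 + K0) + `|e'|^-1 * (K1 + K0).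
apply: (@ler_eps _ _ _ D) => N.
pose W r := r^-1 *: (euler (fun z => u z + r *: h z) N.+1 x - euler u N.+1 x).
have dW r : r != 0 -> `|r| <= 1 ->
    `|dquot u h r x - W r| <= `|r|^-1 * (K1 + K0) / N.+1%:R.
  move=> r0 r1; rewrite /dquot /W -scalerBr normrZ normfV -mulrA ler_wpM2l ?invr_ge0 //.
  have H1 := Exp_euler N x (bl r r1); have H2 := Exp_euler N x bu.
  rewrite opprD addrACA -opprD mulrDl; apply: le_trans (ler_normB _ _) _.
  exact: lerD.
have -> : dquot u h e x - dquot u h e' x =
   (W e - W e') + (dquot u h e x - W e) - (dquot u h e' x - W e').
  move: (W e) (W e') (dquot u h e x) (dquot u h e' x) => p q a b.
  by apply/rowP => i; rewrite !mxE; ring.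
rewrite (_ : D / N.+1%:R = `|e|^-1 * (K1 + K0) / N.+1%:R + `|e'|^-1 * (K1 + K0) / N.+1%:R).
  rewrite [leRHS]addrA.
  apply: le_trans (ler_normB _ _) _; apply: lerD; last exact: dW.
  by apply: le_trans (ler_normD _ _) _; apply: lerD; [exact: HC|exact: dW].
exact: mulrDl.
Qed.

Lemma dquot_dExp B : 0 <= B -> exists2 C, 0 <= C &
  forall u h, cbnv 2 B u -> cbnv 2 B h ->
  (forall e e' x, e != 0 -> e' != 0 -> `|e| <= 1 -> `|e'| <= 1 ->
     `|dquot u h e x - dquot u h e' x| <= C * (`|e| + `|e'|)) /\
  (forall e x, e != 0 -> `|e| <= 1 -> `|dquot u h e x - dExp u h x| <= C * `|e|).
Proof.
move=> B0; have [C C0 HC] := dquot_second_difference B0.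
exists C => // u h cu ch; split=> [e e' x *|]; first exact: HC.
have Nn N : (N.+1%:R : R)^-1 != 0 by rewrite invr_eq0 pnatr_eq0.
have N0 N : `|(N.+1%:R : R)^-1| = N.+1%:R^-1 by rewrite ger0_norm // invr_ge0.
have N1 N : `|(N.+1%:R : R)^-1| <= 1 by rewrite N0; have /andP[] := @invn_itv R N.
have [w wP] : exists w, vucv (fun N => dquot u h N.+1%:R^-1) w.
  apply: vucv_cauchy => d d0; exists (Num.truncn (2 * C / d)) => m p x Nm Np.
  apply: le_trans (HC _ _ _ _ x cu ch (Nn m) (Nn p) (N1 m) (N1 p)) _; rewrite !N0.
  have H q : (Num.truncn (2 * C / d) <= q)%N -> C / q.+1%:R <= d / 2.
    move=> Nq; rewrite ler_pdivrMr ?ltr0n // mulrC -ler_pdivrMr ?divr_gt0 //.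
    have -> : C / (d / 2) = 2 * C / d by field; rewrite gt_eqF.
    by apply: ltW; apply: lt_le_trans (truncnS_gt _) _; rewrite ler_nat ltnS.
  by rewrite mulrDr [leRHS](splitr d) lerD // H.
have {w wP} Dv : vucv (fun N => dquot u h N.+1%:R^-1) (dExp u h).
  rewrite /dExp; case: pselect => [q|[]]; last by exists w.
  exact: svalP (cid q).
move=> e x e0 e1; apply: (@ler_eps _ _ _ (C + 1)) => N.
have N0' : 0 < (N.+1%:R : R)^-1 by rewrite invr_gt0.
have [P HP] := Dv _ N0'; have := HP (maxn P N) x (leq_maxl _ _) => H1.
have := HC u h e _ x cu ch e0 (Nn (maxn P N)) e1 (N1 (maxn P N)) => H2.
apply: le_trans (ler_distD (dquot u h (maxn P N).+1%:R^-1 x) _ _) _.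
apply: le_trans (lerD H2 H1) _.
rewrite mulrDr -addrA lerD2l mulrDl mul1r lerD2r ler_wpM2l // N0.
by rewrite lef_pV2 ?posrE ?ltr0n // ler_nat ltnS leq_maxr.
Qed.

End DirectionalDerivative.

(** * Convergence of the quotients in C^k and continuity of the derivative *)

Section ExpC1.
Context {R : realType} {n : nat}.
Local Notation V := 'rV[R]_n.
Implicit Types (u v w h : V -> V) (x y c : V) (B M L s e : R).

Lemma comp_dist u v i x y : `|comp i u x - comp i v y| <= `|u x - v y|.
Proof. by have := rv_entry (u x - v y) i; rewrite !mxE. Qed.

Lemma dquotE u h e : dquot u h e =
  fun x => e^-1 *: ((Exp (fun z => u z + e *: h z) x - x) - (Exp u x - x)).
Proof.
apply/funext => x; rewrite /dquot; congr (_ *: _).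
by rewrite opprB addrA subrK.
Qed.

Lemma dquot_cbnv m B : 0 <= B -> exists2 B1, 0 <= B1 &
  forall u h e, CBv u -> CBv h -> cbnv m.+1 B u -> cbnv m.+1 B h -> e != 0 -> `|e| <= 1 ->
  cbnv m (2 * B1 / `|e|) (dquot u h e).
Proof.
move=> B0; have B20 : 0 <= 2 * B by rewrite mulr_ge0.
have [B1 B10 H] := @Exp_cbnv R n m _ B20.
exists B1 => // u h e Cu Ch cu ch e0 e1.
have c1 := H _ (CBvD Cu (CBvZ e Ch)) (cbnv_perturb B0 cu ch e1).
have c2 : cbnv m B1 (fun x => Exp u x - x).
  by apply: H => //; apply: cbnvW cu => //; rewrite ler_peMl // ler1n.
rewrite dquotE; apply: cbnvW (cbnvZ e^-1 (cbnvB c1 c2)) => //.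
by rewrite normfV mulrC mulr_natl mulr2n.
Qed.

Lemma CinfapB u v : Cinfap_v u -> Cinfap_v v -> Cinfap_v (fun x => u x - v x).
Proof.
move=> /Cinfap_vP[Cu au] /Cinfap_vP[Cv av]; apply/Cinfap_vP; split; first exact: CBvB.
apply: apv_close2 au av => e e0; exists (e / 2) => [|c c' H1 H2 x]; first by rewrite divr_gt0.
rewrite opprD addrACA -opprD; apply: le_trans (ler_normB _ _) _.
by rewrite [leRHS](splitr e) lerD.
Qed.

Lemma CinfapD u v : Cinfap_v u -> Cinfap_v v -> Cinfap_v (fun x => u x + v x).
Proof.
move=> cu /(CinfapZ (-1)) cv; have := CinfapB cu cv; congr Cinfap_v; apply/funext => x.
by rewrite scaleN1r opprK.
Qed.

Lemma dquot_Cinfap u h e : Cinfap_v u -> Cinfap_v h -> Cinfap_v (dquot u h e).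
Proof.
move=> cu ch; rewrite dquotE; apply: CinfapZ; apply: CinfapB; apply: Exp_Cinfap => //.
by apply: CinfapD => //; exact: CinfapZ.
Qed.

Lemma expr_small (r C d : R) : 0 < r < 1 -> 0 <= C -> 0 < d ->
  exists N, forall p, (N <= p)%N -> C * r ^+ p <= d.
Proof.
move=> /andP[r0 r1] C0 d0; have C1 : 0 < C + 1 by rewrite ltr_wpDl.
have : (GRing.exp r @ \oo --> (0 : R))%classic by apply: cvg_expr; rewrite gtr0_norm.
move/cvgrPdist_le => /(_ (d / (C + 1))); rewrite divr_gt0 // => /(_ isT)[N _ H].
exists N => p Np; have := H p Np; rewrite /= sub0r normrN ger0_norm ?exprn_ge0 ?(ltW r0) //.
rewrite ler_pdivlMr // mulrC; apply: le_trans.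
by rewrite ler_wpM2r ?lerDl // exprn_ge0 // ltW.
Qed.

(** [cbn_geometric] turns the O(1/e) bounds on the quotients into a bound along a geometric sequence
    that depends on [B] only, and [cbn_ucv] passes it to the limit at the cost of one order. *)
Lemma dExp_cbnv m : exists K : nat, forall B, 0 <= B -> exists2 B', 0 <= B' &
  forall u h, CBv u -> CBv h -> cbnv K B u -> cbnv K B h -> cbnv m B' (dExp u h).
Proof.
have [K0 [r r01 H]] := @cbn_geometric R n m.+1.
exists (maxn K0.+1 2) => B B0.
have [C C0 HC] := @dquot_dExp R n B B0; have [B1 B10 HB] := @dquot_cbnv K0 B B0.
have [M HM] := H C (2 * B1); exists `|M| => // u h Cu Ch cu ch i.
have [cu2 ch2] : cbnv 2 B u /\ cbnv 2 B h.
  by split; [apply: cbnvW cu|apply: cbnvW ch]; rewrite ?leq_maxr.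
have [cuK chK] : cbnv K0.+1 B u /\ cbnv K0.+1 B h.
  by split; [apply: cbnvW cu|apply: cbnvW ch]; rewrite ?leq_maxl.
have [D1 D2] := HC u h cu2 ch2.
have pos t : 0 < t <= 1 -> [/\ t != 0 :> R, `|t| <= 1 & `|t| = t].
  by move=> /andP[t0 t1]; rewrite (gtr0_norm t0) gt_eqF.
apply: (@cbn_ucv R n m _ (fun p => comp i (dquot u h (r ^+ p)))) => [p|d d0].
  apply: cbnW (HM (fun t => comp i (dquot u h t)) _ _ p) => //; first exact: ler_norm.
    move=> t s x /pos[t0 t1 tE] /pos[s0 s1 sE]; apply: le_trans (comp_dist _ _ _ _ _) _.
    by have := D1 t s x t0 s0 t1 s1; rewrite tE sE.
  by move=> t /pos[t0 t1 tE]; have := HB u h t Cu Ch cuK chK t0 t1; rewrite tE; apply.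
have [N HN] := expr_small r01 C0 d0; exists N => p x Np.
apply: le_trans (comp_dist _ _ _ _ _) _; apply: le_trans (HN p Np).
have /pos[t0 t1 tE] : 0 < r ^+ p <= 1.
  by case/andP: r01 => r0 r1; rewrite exprn_gt0 // exprn_ile1 // ltW.
by have := D2 _ x t0 t1; rewrite tE.
Qed.

Lemma dExp_CBv u h : CBv u -> CBv h -> CBv (dExp u h).
Proof.
move=> Cu Ch i m; have [K HK] := dExp_cbnv m.
have [B1 B10 c1] := CBv_bound Cu K; have [B2 B20 c2] := CBv_bound Ch K.
have [B' _ H] := HK (B1 + B2) (addr_ge0 B10 B20); exists B'; apply: H => //.
  by apply: cbnvW c1; rewrite ?lerDl.
by apply: cbnvW c2; rewrite ?lerDr.
Qed.

Lemma CBv_bound2 u h : CBv u -> CBv h -> forall m, exists2 B, 0 <= B & cbnv m B u /\ cbnv m B h.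
Proof.
move=> Cu Ch m; have [B1 B10 c1] := CBv_bound Cu m; have [B2 B20 c2] := CBv_bound Ch m.
exists (B1 + B2); first by rewrite addr_ge0.
by split; [apply: cbnvW c1; rewrite ?lerDl|apply: cbnvW c2; rewrite ?lerDr].
Qed.

Lemma dExp_Cinfap u h : Cinfap_v u -> Cinfap_v h -> Cinfap_v (dExp u h).
Proof.
move=> cu ch; have [[Cu _] [Ch _]] := ((Cinfap_vP u).1 cu, (Cinfap_vP h).1 ch).
apply/Cinfap_vP; split; first exact: dExp_CBv.
have [B B0 [bu bh]] := CBv_bound2 Cu Ch 2.
have [C C0 HC] := @dquot_dExp R n B B0; have [_ D2] := HC u h bu bh.
apply: (@apv_ucv R n (fun N => dquot u h N.+1%:R^-1)) => [N|e e0].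
  by have /Cinfap_vP[] := dquot_Cinfap N.+1%:R^-1 cu ch.
pose N := Num.truncn (C / e); exists N => x.
have Nn : (N.+1%:R : R)^-1 != 0 by rewrite invr_eq0 pnatr_eq0.
have /andP[N0 N1] := @invn_itv R N.
have := D2 _ x Nn; rewrite ger0_norm // => /(_ N1) /le_trans; apply.
rewrite ler_pdivrMr ?ltr0n // mulrC -ler_pdivrMr //.
exact: ltW (truncnS_gt _).
Qed.

Lemma Exp_is_dirder u h : CBv u -> CBv h -> is_dirder Exp u h (dExp u h).
Proof.
move=> Cu Ch k eps eps0; have [K HK] := @cbn_rate R n k.
have [B B0 [bu bh]] := CBv_bound2 Cu Ch (maxn K.+1 2).
have [bu2 bh2] : cbnv 2 B u /\ cbnv 2 B h.
  by split; [apply: cbnvW bu|apply: cbnvW bh]; rewrite ?leq_maxr.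
have [buK bhK] : cbnv K.+1 B u /\ cbnv K.+1 B h.
  by split; [apply: cbnvW bu|apply: cbnvW bh]; rewrite ?leq_maxl.
have [C C0 HC] := @dquot_dExp R n B B0; have [_ D2] := HC u h bu2 bh2.
have [B1 B10 HB] := @dquot_cbnv K B B0.
have [B2 B20 cD] := CBv_bound (dExp_CBv Cu Ch) K.
(* The bound [B2] on the limit may be added to the numerator because |e| <= 1. *)
have [d d0 Hd] := HK C (2 * B1 + B2) eps eps0.
exists (Num.min d 1) => [|e e0]; first by rewrite lt_min d0 ltr01.
rewrite lt_min => /andP[ed /ltW e1]; have en : 0 < `|e| by rewrite normr_gt0.
apply: (@cbnv_nle R n k (fun y => dquot u h e y - dExp u h y)) => i.
apply: (Hd `|e|); first by rewrite en.
  move=> x; apply: le_trans (D2 e x e0 e1).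
  by have := rv_entry (dquot u h e x - dExp u h x) i.
have := cbnvB (HB u h e Cu Ch buK bhK e0 e1) cD; move=> /(_ i); apply: cbnW => //.
by rewrite [leRHS]mulrDl lerD2l ler_pdivlMr // ler_piMr.
Qed.

Lemma CBv_close m B d u v : 0 <= B -> cbnv m B u -> cbnv m d (fun x => v x - u x) ->
  d <= 1 -> cbnv m (B + 1) v.
Proof.
move=> B0 cu cd d1; have := cbnvD cu cd.
have -> : (fun x => u x + (v x - u x)) = v by apply/funext => x; rewrite subrKC.
by apply: cbnvW => //; rewrite lerD2l.
Qed.

Lemma dist_via (p q x y : V) (a b r : R) : `|p - x| <= a -> `|q - y| <= a ->
  `|p - q| <= b -> a + (b + a) <= r -> `|x - y| <= r.
Proof.
move=> px qy pq; apply: le_trans; apply: le_trans (ler_distD p _ _) _.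
apply: lerD; first by rewrite distrC.
by apply: le_trans (ler_distD q _ _) _; apply: lerD.
Qed.

(** For continuity, both derivatives are compared in C^0 with quotients at one common e, fixed
    before the neighbourhood; at fixed e the quotient depends continuously on (u, h) by
    [Exp_stable]. [cbn_small] with the uniform bound [dExp_cbnv] then lifts the estimate to C^k. *)
Lemma Exp_C1F : C1F (@Exp R n).
Proof.
exists dExp; split=> [u h cu ch|u0 h0 cu0 ch0 k eps eps0].
  split; first exact: dExp_Cinfap.
  by apply: Exp_is_dirder; [case/Cinfap_vP: cu|case/Cinfap_vP: ch].
have [[Cu0 _] [Ch0 _]] := ((Cinfap_vP u0).1 cu0, (Cinfap_vP h0).1 ch0).
have [K0 HK0] := @cbn_small R n k; have [K1 HK1] := dExp_cbnv K0.
pose K := maxn K1 2; have [B B0 [bu0 bh0]] := CBv_bound2 Cu0 Ch0 K.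
have B10 : 0 <= B + 1 by rewrite addr_ge0.
have [B' B'0 HB'] := HK1 (B + 1) B10.
have [eta eta0 Heta] := HK0 (B' + B') eps eps0.
have [C C0 HC] := @dquot_dExp R n (B + 1) B10.
pose e := Num.min 1 (eta / (4 * (C + 1))).
have C1 : 0 < C + 1 by rewrite ltr_wpDl.
have e0 : 0 < e by rewrite lt_min ltr01 divr_gt0 // mulr_gt0.
have e1 : e <= 1 by rewrite ge_min lexx.
have en : `|e| = e by rewrite gtr0_norm.
have eC : C * e <= eta / 4.
  apply: (@le_trans _ _ (e * (C + 1))).
    by rewrite mulrC ler_wpM2l ?(ltW e0) // lerDl.
  rewrite -ler_pdivlMr // (_ : eta / 4 / (C + 1) = eta / (4 * (C + 1))).
    by rewrite ge_min lexx orbT.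
  by field; rewrite gt_eqF.
have eC2 : C * e + (eta / 2 + C * e) <= eta by move: eC; clear; lra.
pose A := expR (n%:R * (2 * (B + 1))); have A0 : 0 < A by exact: expR_gt0.
(* The fields [u] differ by at most d and the perturbed fields by at most 2 d, so the quotients
   differ by at most 3 d A / e, which must not exceed eta / 2. *)
pose d := Num.min 1 (eta * e / (6 * A)).
have d0 : 0 < d by rewrite lt_min ltr01 divr_gt0 ?mulr_gt0.
have d1 : d <= 1 by rewrite ge_min lexx.
have dA : e^-1 * (A * (3 * d)) <= eta / 2.
  have : d * (6 * A) <= eta * e by rewrite -ler_pdivlMr ?mulr_gt0 // ge_min lexx orbT.
  by move=> dd; rewrite [leLHS]mulrC ler_pdivrMr //; lra.
exists K; exists d => // u h cu ch nu nh.
have [[Cu _] [Ch _]] := ((Cinfap_vP u).1 cu, (Cinfap_vP h).1 ch).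
have du := nle_cbnv (CBvB Cu Cu0) nu; have dh := nle_cbnv (CBvB Ch Ch0) nh.
have bu := CBv_close B0 bu0 du d1; have bh := CBv_close B0 bh0 dh d1.
have {}bu0 : cbnv K (B + 1) u0 by apply: cbnvW bu0; rewrite ?lerDl.
have {}bh0 : cbnv K (B + 1) h0 by apply: cbnvW bh0; rewrite ?lerDl.
have K2 v : cbnv K (B + 1) v -> cbnv 2 (B + 1) v by apply: cbnvW; rewrite ?leq_maxr.
have KK1 v : cbnv K (B + 1) v -> cbnv K1 (B + 1) v by apply: cbnvW; rewrite ?leq_maxl.
have K3 v : cbnv K (B + 1) v -> cbnv 1 (B + 1) v.
  by move=> /K2; apply: cbnvW.
have [_ D] := HC u h (K2 _ bu) (K2 _ bh).
have [_ D0] := HC u0 h0 (K2 _ bu0) (K2 _ bh0).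
have e1' : `|e| <= 1 by rewrite en.
have bl := perturb_bounded_lipschitz B10 (K3 _ bu) (K3 _ bh) e1'.
have bl0 := perturb_bounded_lipschitz B10 (K3 _ bu0) (K3 _ bh0) e1'.
(* The perturbation by 0 gives the unperturbed fields the same Lipschitz constant as the perturbed
   ones, so that one [A] serves both. *)
have zero1 : `|0 : R| <= 1 by rewrite normr0.
have zl := perturb_bounded_lipschitz B10 (K3 _ bu) (K3 _ bh) zero1.
have zl0 := perturb_bounded_lipschitz B10 (K3 _ bu0) (K3 _ bh0) zero1.
have z0 v g : (fun z : V => v z + 0 *: g z) = v.
  by apply/funext => z; rewrite scale0r addr0.
rewrite !z0 in zl zl0.
have close x : `|dquot u h e x - dquot u0 h0 e x| <= eta / 2.
  have uu y : `|u y - u0 y| <= d by exact: (cbnv_bound y (ltW d0) du).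
  have hh y : `|h y - h0 y| <= d by exact: (cbnv_bound y (ltW d0) dh).
  have H1 := Exp_stable x zl zl0 uu.
  have uh y : `|(u y + e *: h y) - (u0 y + e *: h0 y)| <= 2 * d.
    rewrite opprD addrACA -scalerBr; apply: le_trans (ler_normD _ _) _.
    rewrite mulr2n mulrDl mul1r lerD // normrZ en.
    by apply: le_trans (hh y); rewrite ler_piMl.
  have H2 := Exp_stable x bl bl0 uh.
  rewrite /dquot -scalerBr normrZ normfV en; apply: le_trans dA.
  rewrite ler_wpM2l ?invr_ge0 ?(ltW e0) // opprD addrACA -opprD.
  apply: le_trans (ler_normB _ _) _; apply: le_trans (lerD H2 H1) _.
  by rewrite (_ : A * (3 * d) = A * (2 * d) + A * d) //; ring.
apply: (@cbnv_nle R n k (fun y => dExp u h y - dExp u0 h0 y)) => i; apply: Heta.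
  move=> x; apply: le_trans (_ : `|dExp u h x - dExp u0 h0 x| <= _).
    by have := rv_entry (dExp u h x - dExp u0 h0 x) i.
  have en0 : e != 0 by rewrite gt_eqF.
  have T1 := D e x en0 e1'; have T2 := D0 e x en0 e1'; have T3 := close x.
  rewrite en in T1 T2.
  exact: dist_via T1 T2 T3 eC2.
have c1 := HB' u h Cu Ch (KK1 _ bu) (KK1 _ bh).
have c2 := HB' u0 h0 Cu0 Ch0 (KK1 _ bu0) (KK1 _ bh0).
exact: (cbnvB c1 c2).
Qed.

(** A second-order expansion along e = 1/(N+1) suffices to identify the derivative; it is how the
    values at 0 and at a constant field are computed. *)
Lemma dExpE u h w (K : R) : CBv u -> CBv h ->
  (forall e x, 0 < e <= 1 ->
    `|Exp (fun z => u z + e *: h z) x - Exp u x - e *: w x| <= K * e ^+ 2) ->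
  dExp u h = w.
Proof.
move=> Cu Ch H; have [B B0 [bu bh]] := CBv_bound2 Cu Ch 2.
have [C C0 HC] := @dquot_dExp R n B B0; have [_ D2] := HC u h bu bh.
apply/funext => x; apply/eqP; rewrite -subr_eq0 -normr_le0.
apply: (@ler_eps R _ _ (C + K)) => N; rewrite add0r.
have Nn : (N.+1%:R : R)^-1 != 0 by rewrite invr_eq0 pnatr_eq0.
have Np : 0 < (N.+1%:R : R)^-1 by rewrite invr_gt0.
have /andP[_ N1] := @invn_itv R N.
have nN := gtr0_norm Np.
have := D2 _ x Nn; rewrite nN => /(_ N1) T1.
have N01 : 0 < (N.+1%:R : R)^-1 <= 1 by rewrite Np.
have T2 := H _ x N01.
apply: le_trans (ler_distD (dquot u h N.+1%:R^-1 x) _ _) _.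
rewrite distrC mulrDl lerD // /dquot.
rewrite -(ler_pM2l Np) -{1}nN -normrZ scalerBr scalerA mulfV // scale1r.
apply: le_trans T2 _.
by rewrite le_eqVlt; apply/orP; left; apply/eqP; ring.
Qed.

End ExpC1.

(** * The derivative at zero and at constant fields; sine waves *)

Section SpecialDerivatives.
Context {R : realType} {n : nat}.
Local Notation V := 'rV[R]_n.
Implicit Types (u v w h : V -> V) (x y c : V) (B M L s e : R).

Lemma dExp0 h : CBv h -> dExp (fun=> 0) h = h.
Proof.
move=> Ch; have [M bh] := CBv_bounded_lipschitz Ch; have [M0 L0 _ _] := bh.
set L := n%:R * M in bh L0.
apply: (@dExpE R n _ _ _ (L * M * expR L)) => // [|e x /andP[e0 e1]]; first exact: CBv_cst.
have -> : (fun z : V => 0 + e *: h z) = fun z => e *: h z.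
  by apply/funext => z; rewrite add0r.
rewrite Exp0 -addrA -opprD; apply: le_trans (Exp_first x (bounded_lipschitzZ e bh)) _.
rewrite gtr0_norm // (_ : e * L * (e * M) = L * M * e ^+ 2); last by ring.
rewrite mulrAC ler_wpM2r ?sqr_ge0 // ler_wpM2l ?mulr_ge0 // ler_expR.
by rewrite ler_piMl.
Qed.

Lemma iter_estep_sum s v k x :
  iter k (estep s v) x = x + \sum_(j < k) s *: v (iter j (estep s v) x).
Proof.
elim: k => [|k IH]; first by rewrite big_ord0 addr0.
by rewrite big_ord_recr /= addrA -IH.
Qed.

Lemma Exp_cst c x : Exp (fun=> c) x = x + c.
Proof.
have bc : bounded_lipschitz `|c| 0 (fun=> c).
  by split=> // y z; rewrite subrr normr0 mul0r.
apply/eqP; rewrite -subr_eq0 -normr_le0.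
by have := Exp_first x bc; rewrite !mul0r.
Qed.

(* Along the unperturbed orbit [x + t c] the values of [h] at times [t] and
   [t + 1/2] cancel, so [h] only contributes at second order. *)
Lemma Exp_antiperiodic M L h c e x : bounded_lipschitz M L h ->
  (forall y, h (y + 2^-1 *: c) = - h y) -> 0 <= e <= 1 ->
  `|Exp (fun z => c + e *: h z) x - (x + c)| <= L * M * e ^+ 2.
Proof.
move=> [M0 L0 hM hL] hc /andP[e0 e1].
pose v z := c + e *: h z.
have bv : bounded_lipschitz (`|c| + M) L v.
  split=> // [||y z]; first by rewrite addr_ge0.
    move=> y; apply: le_trans (ler_normD _ _) _; rewrite lerD2l normrZ (ger0_norm e0).
    by apply: le_trans (hM y); rewrite ler_piMl.
  rewrite /v opprD addrACA subrr add0r -scalerBr normrZ (ger0_norm e0).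
  by apply: le_trans (hL y z); rewrite ler_piMl.
pose K := L * (`|c| + M) * expR L.
have K0 : 0 <= K by rewrite !mulr_ge0 ?addr_ge0 ?expR_ge0.
apply: (@ler_eps R _ _ K) => k.
(* An even number of steps makes half a time unit exactly [k.+1] steps, so the values of [h] along
   the straight orbit cancel in pairs with no discretisation error. *)
pose N := (k + k).+2; pose s : R := N%:R^-1.
have NE : N = (k.+1 + k.+1)%N by rewrite /N addSn addnS.
have s0 : 0 <= s by rewrite invr_ge0.
have half : k.+1%:R * s = 2^-1.
  rewrite /s NE natrD; field.
  by rewrite !nat1r -natrD pnatr_eq0.
pose X j := iter j (estep s v) x.
(* The Euler orbit drifts from the straight line by at most [e * M] within unit time; put into the
   Lipschitz bound of e h, this produces [e ^+ 2]. *)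
have near j : `|X j - (x + (j%:R * s) *: c)| <= j%:R * s * (e * M).
  rewrite /X iter_estep_sum.
  have -> : x + \sum_(i < j) s *: v (X i) - (x + (j%:R * s) *: c) =
     \sum_(i < j) (s * e) *: h (X i).
    rewrite opprD addrACA subrr add0r /v.
    under eq_bigr do rewrite scalerDr scalerA.
    rewrite big_split /= sumr_const card_ord -scaler_nat scalerA addrAC subrr add0r.
    by [].
  apply: le_trans (ler_norm_sum _ _ _) _.
  apply: le_trans (ler_sum _ (_ : forall i, _ -> _ <= s * (e * M))) _ => [i _|].
    by rewrite normrZ ger0_norm ?mulr_ge0 // -mulrA !ler_wpM2l.
  by rewrite sumr_const card_ord -[leLHS]mulr_natl !mulrA.
have cancel : \sum_(j < N) (s * e) *: h (x + (j%:R * s) *: c) = 0.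
  rewrite -scaler_sumr -[RHS](scaler0 _ (s * e)); congr (_ *: _).
  rewrite NE big_split_ord /= -big_split /=; apply: big1 => j _.
  rewrite natrD mulrDl half scalerDl (addrC (2^-1 *: c)) addrA hc subrr //.
have euler_est : `|euler v N x - (x + c)| <= L * M * e ^+ 2.
  rewrite /euler -/s iter_estep_sum opprD addrACA subrr add0r.
  have -> : \sum_(j < N) s *: v (iter j (estep s v) x) - c =
    \sum_(j < N) (s * e) *: (h (X j) - h (x + (j%:R * s) *: c)).
    under [RHS]eq_bigr do rewrite scalerBr.
    rewrite sumrB cancel subr0 /v.
    under eq_bigr do rewrite scalerDr scalerA.
    rewrite big_split /= sumr_const card_ord -scaler_nat scalerA.
    by rewrite /s divff ?pnatr_eq0 // scale1r addrAC subrr add0r.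
  apply: le_trans (ler_norm_sum _ _ _) _.
  apply: le_trans (ler_sum _ (_ : forall i, _ -> _ <= s * (L * M * e ^+ 2))) _ => [j _|].
    rewrite normrZ ger0_norm ?mulr_ge0 // -[leLHS]mulrA ler_wpM2l //.
    rewrite (_ : L * M * e ^+ 2 = e * (L * (e * M))); last by ring.
    rewrite ler_wpM2l //; apply: le_trans (hL _ _) _; rewrite ler_wpM2l //.
    apply: le_trans (near j) _; rewrite ler_piMl ?mulr_ge0 //.
    rewrite /s ler_pdivrMr ?ltr0n // mul1r ler_nat; exact: ltnW.
  rewrite sumr_const card_ord -[leLHS]mulr_natl [leLHS]mulrA (_ : N%:R * s = 1) ?mul1r //.
  by rewrite /s divff // pnatr_eq0.
apply: le_trans (ler_distD (euler v N x) _ _) _; rewrite addrC; apply: lerD => //.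
apply: le_trans (Exp_euler (k + k).+1 x bv) _; rewrite ler_wpM2l //.
by rewrite lef_pV2 ?posrE ?ltr0n // ler_nat -/N NE leq_addr.
Qed.

Lemma dExp_antiperiodic h c : CBv h -> (forall y, h (y + 2^-1 *: c) = - h y) ->
  dExp (fun=> c) h = fun=> 0.
Proof.
move=> Ch hc; have [M bh] := CBv_bounded_lipschitz Ch.
apply: (@dExpE R n _ _ _ (n%:R * M * M)) => // [|e x /andP[e0 e1]]; first exact: CBv_cst.
rewrite Exp_cst scaler0 subr0; apply: (Exp_antiperiodic _ bh hc).
by rewrite e1 ltW.
Qed.

Lemma is_derive_of_line (f : V -> R) x (v : V) (d : R) :
  is_derive (0 : R) 1 (fun r => f (x + r *: v)) d -> is_derive x v f d.
Proof.
have E : (fun h : R => h^-1 *: (((fun r => f (x + r *: v)) \o shift (0 : R)) (h *: 1) -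
   f (x + (0 : R) *: v))) = (fun h : R => h^-1 *: ((f \o shift x) (h *: v) - f x)).
  apply/funext => r /=; congr (_ *: (f _ - f _)); last by rewrite scale0r addr0.
  by rewrite [r *: 1]mulr1 addr0 addrC.
by case; rewrite /derivable /derive E => H1 H2; split.
Qed.

(** The phase [t] makes the family stable under differentiation: a derivative is a multiple of the
    wave with phase advanced by pi/2. *)
Definition wave (k : R) (j : 'I_n) (t : R) x : R := sin (k * x 0 j + t).

Lemma is_derive_wave k j t x i :
  is_derive x (evec R i) (wave k j t) (k * (j == i)%:R * wave k j (t + pi / 2) x).
Proof.
apply: is_derive_of_line; rewrite /wave.
have -> : (fun r : R => sin (k * (x + r *: evec R i) 0 j + t)) =
    sin \o (fun r => (k * (j == i)%:R) * r + (k * x 0 j + t)).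
  by apply/funext => r /=; congr sin; rewrite !mxE eqxx /=; ring.
set l := fun r => _.
have dl : is_derive (0 : R) 1 l (k * (j == i)%:R).
  have H1 := @is_deriveZ R R R id (k * (j == i)%:R) 0 1 1 (is_derive_id _ _).
  have H2 := is_derive_cst (k * x 0 j + t : R) (0 : R) (1 : R).
  have := is_deriveD H1 H2; rewrite addr0 /GRing.scale /= mulr1.
  by [].
have := @is_derive1_comp R sin l 0 _ _ (is_derive_sin _) dl.
by rewrite /l mulr0 add0r addrA sinDpihalf [cos _ * _]mulrC.
Qed.

Lemma CB_wave k j t : CB (wave k j t).
Proof.
suff H m : forall t, cbn m ((`|k| + 1) ^+ m) (wave k j t).
  by move=> m; exists ((`|k| + 1) ^+ m).
have k1 : 1 <= `|k| + 1 by rewrite lerDr.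
elim: m => [|m IH] s.
  by split=> // x; rewrite ler_norml sin_geN1 sin_le1.
apply: (cbnS_intro _ (fun i x => is_derive_wave k j s x i)) => [x|i].
  apply: (@le_trans _ _ 1); last by rewrite exprn_ege1.
  by rewrite ler_norml sin_geN1 sin_le1.
apply: cbnW (cbnZ (k * (j == i)%:R) (IH (s + pi / 2))) => //.
rewrite exprS ler_wpM2r ?exprn_ge0 ?addr_ge0 // normrM normr_nat.
by case: eqP => _; rewrite ?mulr1 ?mulr0 ?lerDl ?addr_ge0.
Qed.

(** The range is cut into finitely many cells of width about 1/N and one representative per cell is
    kept; an empty cell contributes the default 0. *)
Lemma totally_bounded_image (f : V -> R) : (forall c, `|f c| <= 1) ->
  totally_bounded (fun e c c' => `|f c - f c'| <= e).
Proof.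
move=> f1 e e0; pose N := Num.truncn (2 / e).
have Ne : 2 / N.+1%:R <= e.
  rewrite ler_pdivrMr ?ltr0n // mulrC -ler_pdivrMr //; exact: ltW (truncnS_gt _).
pose S q := [set c | `|f c + 1 - q%:R / N.+1%:R| <= N.+1%:R^-1]%classic.
exists [seq xget 0 (S q) | q <- iota 0 (2 * N.+1).+1] => c.
have fc := f1 c; rewrite ler_norml in fc; have /andP[fc1 fc2] := fc.
pose q := Num.truncn ((f c + 1) * N.+1%:R).
have f0 : 0 <= f c + 1 by lra.
have Sc : S q c by exact: truncn_dist.
exists (xget 0 (S q)).
  apply/mapP; exists q => //; rewrite mem_iota /= add0n ltnS.
  rewrite /q -(@natrK R (2 * N.+1)) le_truncn // natrM ler_wpM2r //; lra.
have Sg : S q (xget 0 (S q)) by exact: (@xgetI _ 0 _ c).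
apply: le_trans Ne.
rewrite /S /= in Sc Sg; set g := xget _ _ in Sg *.
have -> : f c - f g = (f c + 1 - q%:R / N.+1%:R) - (f g + 1 - q%:R / N.+1%:R) by ring.
apply: le_trans (ler_normB _ _) _.
by rewrite mulrDl mul1r lerD.
Qed.

Definition wave_field k j : V -> V := fun x => wave k j 0 x *: evec R j.

(** By the addition formula a translation enters only through the pair of the cosine and sine of
    [k * c 0 j], which ranges in a bounded set of the plane. *)
Lemma wave_field_Cinfap k j : Cinfap_v (wave_field k j).
Proof.
apply/Cinfap_vP; split=> [i m|].
  have [M cM] := CB_wave k j 0 m; exists (`|evec R j 0 i| * M).
  have -> : comp i (wave_field k j) = fun x => evec R j 0 i * wave k j 0 x.
    by apply/funext => x; rewrite /comp mxE mulrC.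
  exact: cbnZ.
pose C c := cos (k * c 0 j); pose S c := sin (k * c 0 j).
have half (f : V -> R) e c c' a :
   `|f c - f a| <= e / 2 -> `|f c' - f a| <= e / 2 -> `|f c - f c'| <= e.
  move=> H1 H2; apply: le_trans (ler_distD (f a) _ _) _.
  by rewrite [leRHS](splitr e) lerD // distrC.
have tC := @totally_bounded_image C.
have tS := @totally_bounded_image S.
move=> e e0; have e2 : 0 < e / 2 by rewrite divr_gt0.
have [||cs Hcs] := totally_bounded_and (half C) (half S) (tC _) (tS _) e2.
- by move=> c; rewrite ler_norml cos_geN1 cos_le1.
- by move=> c; rewrite ler_norml sin_geN1 sin_le1.
exists cs => c; have [c' c'cs [HC HS]] := Hcs c; exists c' => // x.
rewrite /wave_field -scalerBl normrZ evec_norm mulr1 /wave !addr0 !mxE !mulrDr !sinD.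
rewrite -/(C c) -/(S c) -/(C c') -/(S c').
set p := sin _; set q := cos _.
have p1 : `|p| <= 1 by rewrite ler_norml sin_geN1 sin_le1.
have q1 : `|q| <= 1 by rewrite ler_norml cos_geN1 cos_le1.
have -> : p * C c + q * S c - (p * C c' + q * S c') = p * (C c - C c') + q * (S c - S c') by ring.
apply: le_trans (ler_normD _ _) _; rewrite !normrM [leRHS](splitr e).
by apply: lerD; [apply: le_trans HC|apply: le_trans HS]; rewrite ler_piMl.
Qed.

End SpecialDerivatives.

Theorem theorem3p4 (R : realType) (n : nat) :
  (forall u : 'rV[R]_n -> 'rV[R]_n, Cinfap_v u -> exists phi, is_flow u phi) /\
  (forall (u : 'rV[R]_n -> 'rV[R]_n) (phi1 phi2 : R -> 'rV[R]_n -> 'rV[R]_n),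
     Cinfap_v u -> is_flow u phi1 -> is_flow u phi2 ->
     forall t : R, 0 <= t -> phi1 t = phi2 t) /\
  exists ExpLG : ('rV[R]_n -> 'rV[R]_n) -> ('rV[R]_n -> 'rV[R]_n),
    (forall u, Cinfap_v u -> exists2 phi, is_flow u phi & ExpLG u = phi 1) /\
    C1F ExpLG /\
    (forall h, Cinfap_v h -> is_dirder ExpLG (fun _ => 0) h h) /\
    (forall c : 'rV[R]_n, c != 0 ->
       exists du : 'rV[R]_n -> 'rV[R]_n,
         Cinfap_v du /\ du <> (fun _ => 0) /\
         is_dirder ExpLG (fun _ => c) du (fun _ => 0)).
Proof.
split; first by move=> u cu; exists (flow u); exact: flowP.
split; first by move=> u phi1 phi2 /Cinfap_vP[Cu _]; exact: flow_unique.
exists (@Exp R n); split.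
  move=> u cu; exists (flow u); first exact: flowP.
  by rewrite /flow; congr Exp; apply/funext => x; rewrite scale1r.
split; first exact: Exp_C1F.
split=> [h /Cinfap_vP[Ch _]|c c0].
  by rewrite -[X in is_dirder _ _ _ X](dExp0 Ch); apply: Exp_is_dirder => //; exact: CBv_cst.
have /rV0Pn[j cj] := c0.
(* The frequency is chosen so that a shift by c/2 adds pi to the phase and changes the sign. *)
pose h : 'rV[R]_n -> 'rV[R]_n := wave_field (2 * pi / c 0 j) j.
have ch : Cinfap_v h by exact: wave_field_Cinfap.
have [Ch _] := (Cinfap_vP h).1 ch.
have hc y : h (y + 2^-1 *: c) = - h y.
  rewrite /h /wave_field -scaleNr; congr (_ *: _); rewrite /wave !addr0 -sinDpi.
  congr sin; rewrite !mxE; field; exact: cj.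
exists h; split => //; split.
  (* At x_j = c_j / 4 the phase is pi/2 and the field takes the value 1. *)
  move=> /(congr1 (fun g : 'rV[R]_n -> 'rV[R]_n => g ((c 0 j / 4) *: evec R j) 0 j)).
  rewrite /h /wave_field /wave addr0 !mxE !eqxx /= !mulr1.
  have -> : 2 * pi / c 0 j * (c 0 j / 4) = pi / 2 by field.
  by rewrite sin_pihalf => /eqP; rewrite oner_eq0.
rewrite -(dExp_antiperiodic Ch hc); apply: Exp_is_dirder => //; exact: CBv_cst.
Qed.
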